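(* Let $D,r>0$, $d\in\mathbb{N}$, and $B,l>0$. Let $\mu_{B,l}^{(d)}$ be a probability measure on $\mathbb{R}^d$ with a density $\mu_{B,l}^{(d)}(a)$ satisfying $$\lim_{|a|\to\infty}\frac{\log\mu_{B,l}^{(d)}(a)}{|a|^l}=-B.$$ Then $$\lim_{t\to\infty}\frac1{(\log t)^l}\log\int_{\mathbb{R}^d}P_0^{d;(r,0)}(\tau_a>t)\,\mu_{B,l}^{(d)}(da)=-B\Big(\frac{D}{2r}\Big)^{\frac l2}.$$
   Context: Brownian motion with diffusion coefficient $D>0$ on $\mathbb{R}^d$ means the diffusion with generator $\frac D2\Delta$. The process with resetting $X(t)$ on $\mathbb{R}^d$ is defined as follows: it performs $d$-dimensional Brownian motion with diffusion coefficient $D$ until an independent exponential clock of rate $r>0$ rings; when the clock rings the process is instantaneously reset to $0$ and continues afresh from there with an independent resetting clock, and so on. Paths are right-continuous. $P_x^{d;(r,0)}$ denotes probabilities for this process started from $x\in\mathbb{R}^d$. Fix $\epsilon_0>0$ once and for all. For $a\in\mathbb{R}^d$, the location time is $\tau_a=\inf\{t\ge0:X(t)=a\}$ if $d=1$, and $\tau_a=\inf\{t\ge0:|X(t)-a|\le\epsilon_0\}$ if $d\ge2$. *)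

(* Defs.v *)
From HB Require Import structures.
From mathcomp Require Import all_boot all_order all_algebra.
From mathcomp Require Import all_classical all_reals all_analysis.

Set Implicit Arguments.
Unset Strict Implicit.
Unset Printing Implicit Defensive.

Import Order.TTheory GRing.Theory Num.Theory.
Import numFieldNormedType.Exports.

Local Open Scope classical_set_scope.
Local Open Scope ring_scope.

(** Points of R^n are [n.-tuple R]: the library equips tuples with the
    sigma-algebra generated by the coordinates, which is the Borel one (it has
    no measurable structure on ['rV[R]_n], whose norm is moreover the sup
    norm). *)
Section euclidean_space.
Context {R : realType}.

Definition eorigin {n : nat} : n.-tuple R := [tuple 0 | i < n].

Definition esub {n : nat} (x y : n.-tuple R) : n.-tuple R :=
  [tuple tnth x i - tnth y i | i < n].

Definition enorm {n : nat} (x : n.-tuple R) : R :=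
  Num.sqrt (\sum_(i < n) tnth x i ^+ 2).

(** The filter of neighbourhoods of infinity, [|a| --> oo]. *)
Definition einfty {n : nat} : set_system (n.-tuple R) :=
  filter_from [set: R] (fun M => [set a | M < enorm a]).

#[global] Instance einfty_filter n : Filter (@einfty n).
Proof.
apply: filter_from_filter; first by exists 0.
move=> M N _ _; exists (Num.max M N) => // a /=.
by rewrite gt_max => /andP[].
Qed.

End euclidean_space.

Section lebesgue_measure_tuple.
Context {R : realType}.
Local Open Scope ereal_scope.

Definition tuple_cons n (p : R * n.-tuple R) : n.+1.-tuple R :=
  [tuple of p.1 :: p.2].

Definition tuple_uncons n (x : n.+1.-tuple R) : R * n.-tuple R :=
  (thead x, [tuple of behead x]).

Lemma tuple_consK n : cancel (@tuple_cons n) (@tuple_uncons n).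
Proof.
by move=> -[x v]; rewrite /tuple_uncons /tuple_cons /= theadE; congr (_, _); exact: val_inj.
Qed.

Lemma tuple_unconsK n : cancel (@tuple_uncons n) (@tuple_cons n).
Proof. by move=> x; rewrite [RHS](tuple_eta x); apply: val_inj. Qed.

Lemma measurable_tuple_cons n : measurable_fun setT (@tuple_cons n).
Proof. exact: measurable_cons. Qed.

Lemma measurable_tuple_uncons n : measurable_fun setT (@tuple_uncons n).
Proof.
apply/measurable_fun_pairP; split; last exact: measurable_behead.
rewrite (_ : _ \o _ = fun x => tnth x ord0); last by [].
exact: measurable_tnth.
Qed.

Section step.
Context (n : nat) (m : {sigma_finite_measure set (n.-tuple R) -> \bar R}).

Definition lebesgue_tuple_step : set (n.+1.-tuple R) -> \bar R :=
  pushforward (lebesgue_measure \x m) (@tuple_cons n).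

Let step0 : lebesgue_tuple_step set0 = 0.
Proof. by rewrite /lebesgue_tuple_step /pushforward preimage_set0 measure0. Qed.

Let step_ge0 A : 0 <= lebesgue_tuple_step A.
Proof. exact: (measure_ge0 (lebesgue_measure \x m)). Qed.

Let step_sigma_additive : semi_sigma_additive lebesgue_tuple_step.
Proof.
move=> F mF tF mUF; rewrite /lebesgue_tuple_step /pushforward preimage_bigcup.
have mpre A : measurable A -> measurable (@tuple_cons n @^-1` A).
  by move=> mA; rewrite -[X in measurable X]setTI; exact: measurable_tuple_cons.
apply: (measure_semi_sigma_additive (s := lebesgue_measure \x m)).
- by move=> k; exact: mpre.
- apply/trivIsetP => i j _ _ ij; rewrite -preimage_setI.
  by move/trivIsetP : tF => /(_ _ _ _ _ ij) ->//; rewrite preimage_set0.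
- by rewrite -preimage_bigcup; exact: mpre.
Qed.

HB.instance Definition _ := isMeasure.Build _ _ _ lebesgue_tuple_step
  step0 step_ge0 step_sigma_additive.

Let step_sigma_finite : sigma_finite setT lebesgue_tuple_step.
Proof.
have /sigma_finiteP[F [TF ndF Foo]] := sigma_finiteT (@lebesgue_measure R).
have /sigma_finiteP[G [TG ndG Goo]] := sigma_finiteT m.
have preK A : @tuple_cons n @^-1` (@tuple_uncons n @^-1` A) = A.
  by apply/seteqP; split=> p /=; rewrite tuple_consK.
exists (fun k => @tuple_uncons n @^-1` (F k `*` G k)).
  rewrite -preimage_bigcup -[LHS](preimage_setT (@tuple_uncons n)).
  congr (_ @^-1` _); rewrite -setXTT TF TG predeqE => -[x y]; split.
    move=> [/= [i _ Fix] [k _ Gky]]; exists (maxn i k) => //; split.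
      by move: x Fix; exact/subsetPset/ndF/leq_maxl.
    by move: y Gky; exact/subsetPset/ndG/leq_maxr.
  by move=> [k _ []/= ? ?]; split; exists k.
move=> k; have [? ?] := Foo k; have [? ?] := Goo k.
split.
  rewrite -[X in measurable X]setTI.
  by apply: measurable_tuple_uncons => //; exact: measurableX.
rewrite /lebesgue_tuple_step /pushforward preK.
by rewrite product_measure1E// lte_mul_pinfty// ge0_fin_numE.
Qed.

HB.instance Definition _ := Measure_isSigmaFinite.Build _ _ _
  lebesgue_tuple_step step_sigma_finite.

End step.

(** Lebesgue measure on R^n, as an iterated product. *)
Fixpoint lebesgue_tuple n : {sigma_finite_measure set (n.-tuple R) -> \bar R} :=
  if n is n'.+1 then lebesgue_tuple_step (lebesgue_tuple n')
  else \d_([tuple] : 0.-tuple R).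

End lebesgue_measure_tuple.

Section independence.
Context {R : realType} {d0 : measure_display} {Omega : measurableType d0}.
Variable P : probability Omega R.
Local Open Scope ereal_scope.

Definition mutually_independent (I : choiceType)
    (F : I -> set_system Omega) : Prop :=
  forall (J : seq I) (A : I -> set Omega), uniq J ->
    (forall j, j \in J -> F j (A j)) ->
    P (\bigcap_(j in [set` J]) A j) = \prod_(j <- J) P (A j).

Definition independent2 (F G : set_system Omega) : Prop :=
  forall A B, F A -> G B -> P (A `&` B) = P A * P B.

(** The sigma-algebra generated by the variables [Y t], [t] in [D]. *)
Definition sigma_process {T : Type} {d1} {S : measurableType d1}
    (D : set T) (Y : T -> Omega -> S) : set_system Omega :=
  <<s \bigcup_(t in D) preimage_set_system setT (Y t) measurable >>.

Definition sigma_variable {d1} {S : measurableType d1} (Y : Omega -> S) :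
    set_system Omega :=
  preimage_set_system setT Y measurable.

End independence.

Section resetting.
Context {R : realType} {d0 : measure_display} {Omega : measurableType d0}.
Variable P : probability Omega R.
Context {d : nat}.
Implicit Types (x : d.-tuple R) (W X : R -> Omega -> d.-tuple R).

(** Brownian motion with generator [D/2 Laplacian]: increments over [[s, t]]
    have law N(0, D (t - s) I_d). [normal_prob] takes the standard deviation. *)
Record brownian_motion (D : R) (x : d.-tuple R) W : Prop := BrownianMotion {
  bm_measurable : forall t, 0 <= t -> measurable_fun setT (W t) ;
  bm_start : forall w, W 0 w = x ;
  bm_continuous : forall w i,
    {within `[0, +oo[, continuous (fun t => tnth (W t w) i)} ;
  bm_independent_increments : forall s t, 0 <= s -> s <= t ->
    independent2 P (sigma_process `[0, s] W)
                   (sigma_variable (fun w => esub (W t w) (W s w))) ;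
  bm_gaussian_increments : forall s t, 0 <= s -> s < t ->
    forall A : 'I_d -> set R, (forall i, measurable (A i)) ->
    P [set w | forall i, A i (tnth (esub (W t w) (W s w)) i)] =
    (\prod_(i < d) normal_prob 0 (Num.sqrt (D * (t - s))) (A i))%E }.

Definition exponential_clock (r : R) (T : Omega -> R) : Prop :=
  [/\ measurable_fun setT T, (forall w, 0 <= T w) &
      forall A, measurable A -> P (T @^-1` A) = exponential_prob r A].

(** [S_k = T_0 + ... + T_(k-1)], the time of the [k]-th reset ([S_0 = 0]). *)
Definition reset_time (T : nat -> Omega -> R) (k : nat) (w : Omega) : R :=
  \sum_(j < k) T j w.

(** [W k] drives the motion between the [k]-th and the [k.+1]-th reset and [T k]
    is the clock running meanwhile. That the resets do not accumulate is almost
    sure for exponential clocks; it is required surely, as continuity is, so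
    that [X] is everywhere defined. *)
Definition resetting_brownian_motion (D r : R) (x : d.-tuple R) X : Prop :=
  exists (W : nat -> R -> Omega -> d.-tuple R) (T : nat -> Omega -> R),
  [/\ forall k, brownian_motion D (if k is 0%N then x else eorigin) (W k),
      forall k, exponential_clock r (T k),
      mutually_independent P (fun j : nat + nat =>
        match j with
        | inl k => sigma_process `[0, +oo[ (W k)
        | inr k => sigma_variable (T k)
        end),
      forall w t, 0 <= t ->
        exists k, reset_time T k w <= t < reset_time T k.+1 w &
      forall w t k, reset_time T k w <= t < reset_time T k.+1 w ->
        X t w = W k (t - reset_time T k w) w].

End resetting.

Section location.
Context {R : realType} {d : nat}.

Definition location_target (eps0 : R) (a : d.-tuple R) : set (d.-tuple R) :=
  if d == 1%N then [set a] else [set y | enorm (esub y a) <= eps0].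

(** [+oo] when the path never meets the target. *)
Definition location_time (eps0 : R) (a : d.-tuple R) (p : R -> d.-tuple R) :
    \bar R :=
  ereal_inf [set t%:E | t in [set t | 0 <= t /\ location_target eps0 a (p t)]].

End location.

Definition has_density {R : realType} {d : nat}
    (mu : probability (d.-tuple R) R) (f : d.-tuple R -> R) : Prop :=
  [/\ measurable_fun setT f, (forall a, 0 <= f a) &
      forall A, measurable A ->
        mu A = (\int[lebesgue_tuple d]_(a in A) (f a)%:E)%E].

(* Main.v *)
Require Import Defs.
From HB Require Import structures.
From mathcomp Require Import all_boot all_order all_algebra.
From mathcomp Require Import all_classical all_reals all_analysis.
From mathcomp Require Import measurable_realfun.
From mathcomp Require Import ring lra.

Set Implicit Arguments.
Unset Strict Implicit.
Unset Printing Implicit Defensive.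

Import Order.TTheory GRing.Theory Num.Theory.
Import numFieldNormedType.Exports.

Local Open Scope classical_set_scope.
Local Open Scope ring_scope.

(** Put kappa = sqrt (D / (2 r)) and t = exp s. Between two resets the
    target at [a] is hit with probability about exp (- |a| / kappa):
    reaching distance |a| in time u costs |a|^2 / (2 D u), keeping the clock
    silent until u costs r u, and the best u gives |a| / kappa. Up to time t
    there are about t = exp s independent attempts. Hence a target with |a|
    < (1 - delta) kappa s is hit with overwhelming probability, and a target
    with |a| > (1 + delta) kappa s is missed with probability at least 1/2.
    The averaged survival probability is therefore comparable to the mass of
    the region |a| > kappa s, which is exp (- B (kappa s)^l) up to factors
    close to 1 in the exponent; the exponent divided by s^l is the limit.

    Every estimate of the attempts is made with events rather than with
    expectations, since the law of the motion is given on boxes only. For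
    the lower bound on a hit ([cycle_hit_bound]), at time u the motion lies
    in a small box just beyond [a], which forces a hit ([outward_box_hit]).
    For the upper bound ([killed_hit_le]), a motion that comes near [a]
    afterwards moves, with probability bounded below, further into the
    orthant of [a]; so up to a constant the hitting probability is the
    probability of finding the motion, up to a bounded distance, beyond [a]
    in every coordinate at a fixed time ([bm_grid_reflection]), and Chernoff
    bounds for the coordinates, with tilts proportional to those of [a],
    multiply to the exponential of the Euclidean distance
    ([bm_grid_hit_le]).

    The number of attempts is controlled in the same way: survival until t
    requires a long cycle among the first t^(1 - eps), or that all of these
    cycles miss the target, and both have a doubly exponentially small
    probability in s ([survival_le], [survival_near_le]); a hit before t
    requires a hit in one of t log t cycles, or that these cycles are
    exceptionally short ([hit_le], [survival_far_ge]). The events compared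
    are measurable because paths are continuous between resets and the
    target is closed ([measurable_survival]); the integrand as a function of
    [a] is only compared with measurable functions ([le_integral_ge0]). *)

(** * Comparisons of measurable functions and Gaussian estimates on the line *)

Section measurable_comparison.
Context {R : realType} {dd : measure_display} {T : measurableType dd}.
Implicit Types f g : T -> R.

Lemma measurable_set_le f g : measurable_fun setT f -> measurable_fun setT g ->
  measurable [set x | f x <= g x].
Proof.
move=> mf mg; rewrite (_ : [set x | _] = (fun x => f x <= g x) @^-1` [set true]).
  rewrite -[X in measurable X]setTI.
  exact: (measurable_fun_ler mf mg measurableT).
by apply/seteqP; split.
Qed.

Lemma measurable_set_lt f g : measurable_fun setT f -> measurable_fun setT g ->
  measurable [set x | f x < g x].
Proof.
move=> mf mg; rewrite (_ : [set x | _] = (fun x => f x < g x) @^-1` [set true]).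
  rewrite -[X in measurable X]setTI.
  exact: (measurable_fun_ltr mf mg measurableT).
by apply/seteqP; split.
Qed.

End measurable_comparison.

Section gaussian_line.
Context {R : realType}.
Implicit Types (c s x y m theta : R).

Lemma normal_pdf_tilt s theta y : s != 0 ->
  expR (theta * y) * normal_pdf 0 s y =
  expR (theta ^+ 2 * s ^+ 2 / 2) * normal_pdf (theta * s ^+ 2) s y.
Proof.
move=> s0; rewrite !normal_pdfE// /normal_fun.
rewrite ![expR _ * (normal_peak s * _)]mulrCA -!expRD; congr (_ * expR _).
by rewrite -mulr_natr; field.
Qed.

(** Multiplying by exp (theta (e y - c)), which is at least 1 on the half-line,
    turns the density into that of a Gaussian with another mean, up to the factor
    on the right. *)
Lemma normal_prob_chernoff s theta c (e : R) : s != 0 -> 0 <= theta ->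
    e ^+ 2 = 1 ->
  (normal_prob 0 s [set y | c <= e * y]%R <=
    (expR (- theta * c + theta ^+ 2 * s ^+ 2 / 2))%:E)%E.
Proof.
move=> s0 th0 e2.
have mA : measurable [set y | c <= e * y]%R.
  by apply: measurable_set_le => //; exact: measurable_funM.
pose k := expR (- theta * c + theta ^+ 2 * s ^+ 2 / 2).
apply: (@le_trans _ _
  (\int[lebesgue_measure]_(y in [set y | c <= e * y]%R)
    (k%:E * (normal_pdf (theta * e * s ^+ 2) s y)%:E))%E).
  apply: ge0_le_integral => //=.
  - by move=> y _; rewrite lee_fin normal_pdf_ge0.
  - apply/measurable_EFinP/measurable_funTS; exact: measurable_normal_pdf.
  - apply/measurable_EFinP/measurable_funM => //.
    by apply/measurable_funTS; exact: measurable_normal_pdf.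
  - move=> y cey; rewrite -EFinM lee_fin.
    have := normal_pdf_tilt (theta * e) y s0.
    rewrite exprMn e2 mulr1 => tilt.
    rewrite /k (expRD (- theta * c)) -[leRHS]mulrA -tilt mulrA -expRD.
    rewrite ler_peMl ?normal_pdf_ge0//.
    rewrite -[leLHS]expR0 ler_expR.
    by have := ler_wpM2l th0 cey; lra.
rewrite ge0_integralZl//; last 3 first.
- apply/measurable_EFinP/measurable_funTS; exact: measurable_normal_pdf.
- by move=> y _; rewrite lee_fin normal_pdf_ge0.
- by rewrite lee_fin expR_ge0.
rewrite -[leRHS]mule1 lee_wpmul2l ?lee_fin ?expR_ge0//.
exact: (@probability_le1 _ _ _ (normal_prob (theta * e * s ^+ 2) s)).
Qed.

Lemma normal_prob_itv_ge s x y m : s != 0 -> x <= y -> `|x| <= m -> `|y| <= m ->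
  (((y - x) * (normal_peak s * expR (- m ^+ 2 / (s ^+ 2 * 2))))%:E <=
    normal_prob 0 s `[x, y])%E.
Proof.
move=> s0 xy xm ym.
apply: (@le_trans _ _ (\int[lebesgue_measure]_(z in `[x, y])
    (normal_peak s * expR (- m ^+ 2 / (s ^+ 2 * 2)))%:E)%E).
  rewrite integral_cst// [X in (_ * X)%E](_ : _ = (y - x)%:E); last first.
    rewrite [LHS](lebesgue_measure_itv `[x, y]) /= lte_fin.
    move: xy; rewrite le_eqVlt => /predU1P[->|->]; last by rewrite -EFinD.
    by rewrite ltxx subrr.
  by rewrite -EFinM lee_fin mulrC.
apply: ge0_le_integral => //=.
- by move=> z _; rewrite lee_fin mulr_ge0 ?expR_ge0// normal_peak_ge0.
- by apply/measurable_EFinP/measurable_funTS; exact: measurable_normal_pdf.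
- move=> z; rewrite in_itv/= => /andP[xz zy].
  rewrite lee_fin normal_pdfE// ler_wpM2l ?normal_peak_ge0//.
  rewrite /normal_fun ler_expR subr0 -[s ^+ 2 *+ 2]mulr_natr ler_wpM2r//.
    by rewrite invr_ge0 mulr_ge0// sqr_ge0.
  rewrite lerN2 -[leLHS]real_normK ?num_real// lerXn2r ?nnegrE//.
    exact: le_trans xm.
  by move: xm ym; rewrite !ler_norml => /andP[? ?] /andP[? ?]; apply/andP; split; lra.
Qed.

(** The width s of the interval from 0 to s times the value at s of the Gaussian
    density with standard deviation s; it does not depend on s. *)
Definition half_line_bound : R := (Num.sqrt (pi *+ 2))^-1 * expR (- 2^-1).

Lemma half_line_bound_gt0 : 0 < half_line_bound.
Proof.
by rewrite mulr_gt0 ?expR_gt0// invr_gt0 sqrtr_gt0 mulrn_wgt0// pi_gt0.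
Qed.

Lemma normal_prob_half_line_ge s (e : R) : 0 < s -> e = 1 \/ e = -1 ->
  (half_line_bound%:E <= normal_prob 0 s [set y | 0 <= e * y]%R)%E.
Proof.
move=> s0 e1.
have mA : measurable [set y | 0 <= e * y]%R.
  by apply: measurable_set_le => //; exact: measurable_funM.
have s0' : s != 0 by rewrite gt_eqF.
have bE : half_line_bound = s * (normal_peak s * expR (- s ^+ 2 / (s ^+ 2 * 2))).
  rewrite /half_line_bound /normal_peak -mulrnAr sqrtrM ?sqr_ge0//.
  rewrite sqrtr_sqr gtr0_norm// invfM !mulrA divff// mul1r; congr (_ * expR _).
  by field.
case: e1 => e1; subst e.
- apply: (@le_trans _ _ (normal_prob 0 s `[0, s])); last first.
    apply: (@le_measure _ _ _ (normal_prob 0 s)); rewrite ?inE//.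
    by move=> y /=; rewrite in_itv/= mul1r => /andP[].
  rewrite bE -[X in (X * (_ * _))]subr0.
  by apply: normal_prob_itv_ge; rewrite ?normr0 ?gtr0_norm// ltW.
- apply: (@le_trans _ _ (normal_prob 0 s `[- s, 0])); last first.
    apply: (@le_measure _ _ _ (normal_prob 0 s)); rewrite ?inE//.
    by move=> y /=; rewrite in_itv/= mulN1r oppr_ge0 => /andP[].
  have := @normal_prob_itv_ge s (- s) 0 s s0'.
  rewrite bE sub0r opprK; apply; rewrite ?normr0 ?normrN ?gtr0_norm// ?ltW//.
  by rewrite oppr_lt0.
Qed.

End gaussian_line.

(** * Euclidean norm, orthants and bounds for unions of events *)

Section euclidean_norm.
Context {R : realType} {d : nat}.
Implicit Types a x y : d.-tuple R.

Lemma enorm_ge0 x : 0 <= enorm x.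
Proof. exact: sqrtr_ge0. Qed.

Lemma enorm_sqr x : enorm x ^+ 2 = \sum_(i < d) tnth x i ^+ 2.
Proof. by rewrite sqr_sqrtr// sumr_ge0// => i _; rewrite sqr_ge0. Qed.

Lemma normr_tnth_le_enorm x i : `|tnth x i| <= enorm x.
Proof.
rewrite -sqrtr_sqr ler_sqrt ?sumr_ge0// => [|j _]; last exact: sqr_ge0.
by rewrite (bigD1 i)//= lerDl sumr_ge0// => j _; rewrite sqr_ge0.
Qed.

Lemma tnth_esub x y i : tnth (esub x y) i = tnth x i - tnth y i.
Proof. by rewrite tnth_mktuple. Qed.

Lemma measurable_enorm : measurable_fun setT (@enorm R d).
Proof.
rewrite (_ : enorm = Num.sqrt \o fun x => \sum_(i < d) tnth x i ^+ 2)//.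
apply: measurableT_comp.
  apply: continuous_measurable_fun; exact: sqrt_continuous.
by apply: measurable_sum => i; apply: measurable_funX; exact: measurable_tnth.
Qed.

Lemma measurable_enorm_esub a :
  measurable_fun setT (fun x : d.-tuple R => enorm (esub x a)).
Proof.
rewrite (_ : (fun x => _) =
    Num.sqrt \o fun x => \sum_(i < d) (tnth x i - tnth a i) ^+ 2); last first.
  apply/funext => x /=; congr Num.sqrt.
  by apply: eq_bigr => i _; rewrite tnth_esub.
apply: measurableT_comp.
  apply: continuous_measurable_fun; exact: sqrt_continuous.
apply: measurable_sum => i; apply: measurable_funX.
by apply: measurable_funB => //; exact: measurable_tnth.
Qed.

Lemma measurable_tuple_box (n : nat) (A : 'I_n -> set R) :
    (forall i, measurable (A i)) ->
  measurable [set x : n.-tuple R | forall i, A i (tnth x i)].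
Proof.
move=> mA; rewrite (_ : [set _ | _] = \bigcap_(i in [set: 'I_n])
    ((fun x : n.-tuple R => tnth x i) @^-1` A i)).
  apply: fin_bigcap_measurable => // i _.
  rewrite -[X in measurable X]setTI; exact: (measurable_tnth i).
by apply/seteqP; split=> x /= Hx i => [_|]; exact: Hx.
Qed.

(** Coordinatewise signs of a point; the sign of 0 is chosen to be 1, so that
    the signs always single out an orthant. *)
Definition orthant_sign a (i : 'I_d) : R := if 0 <= tnth a i then 1 else -1.

Lemma orthant_signP a i : orthant_sign a i = 1 \/ orthant_sign a i = -1.
Proof. by rewrite /orthant_sign; case: ifP; [left|right]. Qed.

Lemma orthant_sign_sqr a i : orthant_sign a i ^+ 2 = 1.
Proof. by case: (orthant_signP a i) => ->; rewrite ?sqrrN expr1n. Qed.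

Lemma orthant_signE a i : orthant_sign a i * tnth a i = `|tnth a i|.
Proof.
rewrite /orthant_sign; case: ifPn => a0; first by rewrite mul1r ger0_norm.
by rewrite mulN1r ltr0_norm// ltNge.
Qed.

Lemma ball_sub_orthant rho a x i : enorm (esub x a) <= rho ->
  `|tnth a i| - rho <= orthant_sign a i * tnth x i.
Proof.
move=> /(le_trans (normr_tnth_le_enorm _ i)); rewrite tnth_esub.
rewrite -orthant_signE ler_norml.
by case: (orthant_signP a i) => -> /andP[]; lra.
Qed.

End euclidean_norm.

Section probability_toolbox.
Context {R : realType} {dd : measure_display} {Omega : measurableType dd}.
Variable P : probability Omega R.
Local Open Scope ereal_scope.

Lemma le_prode (I : Type) (s : seq I) (f g : I -> \bar R) :
    (forall i, 0 <= f i) -> (forall i, f i <= g i) ->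
  \prod_(i <- s) f i <= \prod_(i <- s) g i.
Proof.
move=> f0 fg; suff [] : 0 <= \prod_(i <- s) f i /\
  \prod_(i <- s) f i <= \prod_(i <- s) g i by [].
elim/big_rec2 : _ => [|i x y _ [y0 yx]]; first by rewrite lee01.
by split; [exact: mule_ge0|exact: lee_pmul].
Qed.

Lemma probability_bigcup_nondecreasing_le (F : (set Omega)^nat) (x : \bar R) :
    (forall n, measurable (F n)) -> nondecreasing_seq F ->
    (forall n, P (F n) <= x) ->
  P (\bigcup_n F n) <= x.
Proof.
move=> mF ndF Fx.
have cF := @nondecreasing_cvg_mu _ _ _ P F mF (bigcupT_measurable F mF) ndF.
rewrite -(cvg_lim _ cF)//; apply: lime_le; first by apply: cvgP cF.
by apply: nearW => n; exact: Fx.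
Qed.

Lemma probability_bigcup_geometric_le (F : (set Omega)^nat) (a q : R) :
    (forall n, measurable (F n)) -> (0 <= a)%R -> (0 < q < 1)%R ->
    (forall n, P (F n) <= (a * q ^+ n)%:E) ->
  P (\bigcup_n F n) <= (a / (1 - q))%:E.
Proof.
move=> mF a0 /andP[q0 q1] Fq.
apply: (le_trans (measure_sigma_subadditive P mF (bigcupT_measurable F mF) _)) => //.
apply: lime_le; first exact: is_cvg_nneseries.
apply: nearW => n; apply: (@le_trans _ _ (\sum_(0 <= i < n) (a * q ^+ i)%:E)).
  by apply: lee_sum => i _; exact: Fq.
rewrite sumEFin lee_fin; apply: geometric_le_lim => //.
by rewrite ger0_norm// ltW.
Qed.

Lemma probability_bigsetU_le (F : (set Omega)^nat) (c : R) (n : nat) :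
    (forall k, measurable (F k)) -> (forall k, P (F k) <= c%:E) ->
  P (\big[setU/set0]_(k < n) F k) <= (n%:R * c)%:E.
Proof.
move=> mF Fc; apply: (le_trans (@Boole_inequality _ _ _ P F n _)) => //.
apply: (@le_trans _ _ (\sum_(k < n) c%:E)); first by apply: lee_sum => k _; exact: Fc.
by rewrite sumEFin sumr_const card_ord mulr_natl.
Qed.

End probability_toolbox.

Section generated_sigma_algebra.
Context {T : pointedType} (G : set_system T).

(** Membership in <<s G>> is measurability in the type g_sigma_algebraType G. *)
Lemma sigma_algebra_seqDU (F : (set T)^nat) n :
  (forall k, (k <= n)%N -> <<s G >> (F k)) -> <<s G >> (seqDU F n).
Proof.
move=> GF.
have mF k : (k <= n)%N -> measurable (F k : set (g_sigma_algebraType G)).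
  exact: GF.
apply: (@measurableD _ (g_sigma_algebraType G)); first exact: mF.
by apply: bigsetU_measurable => k _; apply: mF; exact/ltnW/ltn_ord.
Qed.

Lemma sigma_algebra_bigsetU (F : (set T)^nat) n :
  (forall k, <<s G >> (F k)) -> <<s G >> (\big[setU/set0]_(k < n) F k).
Proof.
move=> GF; apply: (@bigsetU_measurable _ (g_sigma_algebraType G)) => k _.
exact: GF.
Qed.

End generated_sigma_algebra.

(** * Brownian motion near and beyond a target *)

Section brownian_estimates.
Context {R : realType} {dd : measure_display} {Omega : measurableType dd}.
Variable P : probability Omega R.
Context {d : nat}.
Variables (D : R) (W : R -> Omega -> d.-tuple R).
Hypotheses (D_gt0 : 0 < D) (bmW : brownian_motion P D eorigin W).
Implicit Types a : d.-tuple R.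

Lemma sigma_process_event (I : set R) t (A : set (d.-tuple R)) :
  I t -> measurable A -> sigma_process I W (W t @^-1` A).
Proof.
move=> It mA; apply: sub_sigma_algebra; exists t => //.
by exists A => //; rewrite setTI.
Qed.

Lemma measurable_bm_event t (A : set (d.-tuple R)) :
  0 <= t -> measurable A -> measurable (W t @^-1` A).
Proof.
by move=> t0 mA; rewrite -[X in measurable X]setTI; exact: (bm_measurable bmW).
Qed.

Lemma measurable_orthant (e b : 'I_d -> R) :
  measurable [set y : d.-tuple R | forall i, b i <= e i * tnth y i].
Proof.
apply: (@measurable_tuple_box R d (fun i => [set y | b i <= e i * y])) => i.
by apply: measurable_set_le => //; exact: measurable_funM.
Qed.

Lemma bm_increment_orthantE (s t : R) (e b : 'I_d -> R) : 0 <= s -> s < t ->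
  P [set w | forall i, b i <= e i * tnth (esub (W t w) (W s w)) i] =
  (\prod_(i < d) normal_prob 0 (Num.sqrt (D * (t - s)))
     [set y | b i <= e i * y]%R)%E.
Proof.
move=> s0 st; rewrite -(bm_gaussian_increments bmW s0 st)// => i.
by apply: measurable_set_le => //; exact: measurable_funM.
Qed.

(** Each first entrance into [B] is followed, with probability at least the
    constant on the left, by an increment that points into the given orthant;
    by independence of the increments these events are disjoint parts of the
    event on the right. *)
Lemma bm_grid_reflection (n : nat) (t : nat -> R) (v : R)
    (B : set (d.-tuple R)) (e b : 'I_d -> R) :
    0 <= v -> (forall j, 0 <= t j) -> {homo t : j k / (j <= k)%N >-> j <= k} ->
    (forall j, (j < n)%N -> t j < v) -> measurable B ->
    (forall i, e i = 1 \/ e i = -1) ->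
    (forall y i, B y -> b i <= e i * tnth y i) ->
  ((half_line_bound ^+ d)%:E * P (\big[setU/set0]_(j < n) (W (t j) @^-1` B)) <=
   P [set w | forall i, b i <= e i * tnth (W v w) i]%R)%E.
Proof.
move=> v0 t0 ndt tv mB e1 Bb.
pose F j := W (t j) @^-1` B.
pose O := [set y : d.-tuple R | forall i, 0 <= e i * tnth y i].
pose G j := (fun w => esub (W v w) (W (t j) w)) @^-1` O.
have mO : measurable O := measurable_orthant e (fun=> 0).
have mF j : measurable (F j) by exact: measurable_bm_event.
have mesub j : (j < n)%N ->
    measurable_fun setT (fun w => esub (W v w) (W (t j) w)).
  move=> jn; apply/measurable_fun_tnthP => i.
  rewrite (_ : _ \o _ = fun w => tnth (W v w) i - tnth (W (t j) w) i); last first.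
    by apply/funext => w /=; rewrite tnth_esub.
  by apply: measurable_funB; apply: measurableT_comp (measurable_tnth i) _;
    exact: (bm_measurable bmW).
have mG j : (j < n)%N -> measurable (G j).
  by move=> jn; rewrite -[X in measurable X]setTI; exact: mesub.
have mH j : measurable (seqDU F j) by exact: seqDU_measurable.
have FG j : (j < n)%N ->
    ((half_line_bound ^+ d)%:E * P (seqDU F j) <= P (seqDU F j `&` G j))%E.
  move=> jn.
  have -> : P (seqDU F j `&` G j) = (P (seqDU F j) * P (G j))%E.
    apply: (bm_independent_increments bmW (t0 j) (ltW (tv j jn))).
      apply: sigma_algebra_seqDU => k kj; apply: sigma_process_event => //=.
      by rewrite in_itv/= t0 ndt.
    by exists O => //; rewrite setTI.
  rewrite muleC; apply: lee_wpmul2l => //.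
  rewrite [X in P X](_ : _ = [set w | forall i,
    0 <= e i * tnth (esub (W v w) (W (t j) w)) i]%R)//.
  rewrite (bm_increment_orthantE e (fun=> 0) (t0 j) (tv j jn)).
  rewrite -[d in leLHS]card_ord -prodr_const -prodEFin.
  apply: le_prode => i; first by rewrite lee_fin ltW// half_line_bound_gt0.
  apply: normal_prob_half_line_ge => //.
  by rewrite sqrtr_gt0 mulr_gt0// subr_gt0 tv.
rewrite (bigsetU_seqDU F) measure_bigsetU_ord//; last first.
  by apply/trivIsetP => i j _ _ ij; have /trivIsetP := trivIset_seqDU F; apply.
rewrite ge0_sume_distrr//.
apply: (@le_trans _ _ (\sum_(j < n) P (seqDU F j `&` G j))%E).
  by apply: lee_sum => j _; exact: FG.
rewrite -measure_bigsetU_ord; last 2 first.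
- by move=> j; apply: measurableI => //; exact: mG.
- apply/trivIsetP => i j _ _ ij; rewrite setIACA.
  by have /trivIsetP -> := trivIset_seqDU F => //; rewrite set0I.
apply: le_measure; rewrite ?inE.
- by apply: bigsetU_measurable => j _; apply: measurableI => //; exact: mG.
- rewrite (_ : [set _ | _] =
    W v @^-1` [set y | forall i, b i <= e i * tnth y i])//.
  by apply: measurable_bm_event => //; exact: measurable_orthant.
- move=> w; rewrite -(bigcup_mkord n (fun j => seqDU F j `&` G j)) => -[j /= jn [Hw Gw]] i.
  have Fw := subset_seqDU Hw.
  have := Bb _ i Fw; have := Gw i; rewrite tnth_esub.
  by case: (e1 i) => ->; lra.
Qed.

(** The coordinates are independent, so that one-dimensional bounds multiply,
    with a tilt that may differ from one coordinate to the other. *)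
Lemma bm_orthant_chernoff (v : R) (e b theta : 'I_d -> R) : 0 < v ->
    (forall i, e i ^+ 2 = 1) -> (forall i, 0 <= theta i) ->
  (P [set w | forall i, b i <= e i * tnth (W v w) i]%R <=
   (expR (- (\sum_(i < d) theta i * b i) +
          (\sum_(i < d) theta i ^+ 2) * (D * v) / 2))%:E)%E.
Proof.
move=> v0 e2 th0; rewrite [X in P X](_ : _ = [set w | forall i,
    b i <= e i * tnth (esub (W v w) (W 0 w)) i]); last first.
  by apply/seteqP; split=> w /= Hw i; move: (Hw i);
    rewrite tnth_esub (bm_start bmW) tnth_mktuple subr0.
rewrite (bm_increment_orthantE e b (lexx 0) v0) subr0.
have Dv0 : 0 < D * v by rewrite mulr_gt0.
have s2 : Num.sqrt (D * v) ^+ 2 = D * v by rewrite sqr_sqrtr// ltW.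
apply: (@le_trans _ _ (\prod_(i < d)
    (expR (- theta i * b i + theta i ^+ 2 * (D * v) / 2))%:E)%E).
  apply: le_prode => i; first exact: measure_ge0.
  by rewrite -{2}s2; apply: normal_prob_chernoff => //; rewrite gt_eqF ?sqrtr_gt0.
rewrite prodEFin -expR_sum lee_fin ler_expR big_split/= -!mulr_suml.
by rewrite lerD2r; under eq_bigr do rewrite mulNr; rewrite sumrN.
Qed.

(** Tilts proportional to the coordinates of [a] and of Euclidean length [g] give
    the exponent [- g * enorm a] of a motion projected on the direction of [a];
    the thickness [rho] of the target costs a constant factor. *)
Lemma bm_grid_hit_le (g rho v : R) a (n : nat) (t : nat -> R) :
    0 <= g -> 0 <= rho -> 0 < v -> 0 < enorm a ->
    (forall j, 0 <= t j) -> {homo t : j k / (j <= k)%N >-> j <= k} ->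
    (forall j, (j < n)%N -> t j < v) ->
  (P (\big[setU/set0]_(j < n) (W (t j) @^-1` [set y | (enorm (esub y a) <= rho)%R])) <=
   (expR (g * rho * d%:R) / half_line_bound ^+ d *
      expR (- g * enorm a + g ^+ 2 * D * v / 2))%:E)%E.
Proof.
move=> g0 rho0 v0 a0 t0 ndt tv.
have mB : measurable [set y : d.-tuple R | (enorm (esub y a) <= rho)%R].
  by apply: measurable_set_le => //; exact: measurable_enorm_esub.
have := @bm_grid_reflection n t v _ (orthant_sign a)
  (fun i => `|tnth a i| - rho) (ltW v0) t0 ndt tv mB (orthant_signP a).
move=> /(_ (fun y i => @ball_sub_orthant _ _ _ _ _ _)).
pose theta i := g * `|tnth a i| / enorm a.
have th0 i : 0 <= theta i by rewrite divr_ge0// ?mulr_ge0// ltW.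
move=> /le_trans/(_ (bm_orthant_chernoff (fun i => `|tnth a i| - rho) v0
  (orthant_sign_sqr a) th0)).
have c0 : 0 < (@half_line_bound R) ^+ d by rewrite exprn_gt0// half_line_bound_gt0.
rewrite muleC -lee_pdivlMr// => /le_trans; apply.
rewrite -EFinM lee_fin [leRHS]mulrAC ler_pM2r ?invr_gt0// -expRD ler_expR.
have -> : \sum_(i < d) theta i ^+ 2 = g ^+ 2.
  under eq_bigr do rewrite /theta expr_div_n exprMn real_normK ?num_real//.
  rewrite -mulr_suml -mulr_sumr -enorm_sqr mulfK//.
  by rewrite expf_neq0// gt_eqF.
rewrite addrA -[g ^+ 2 * D * v]mulrA lerD2r.
have -> : \sum_(i < d) theta i * (`|tnth a i| - rho) =
    g * enorm a - rho * \sum_(i < d) theta i.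
  under eq_bigr do rewrite mulrBr [_ * rho]mulrC.
  rewrite sumrB -mulr_sumr; congr (_ - _).
  transitivity (\sum_(i < d) g / enorm a * tnth a i ^+ 2).
    apply: eq_bigr => i _; rewrite /theta -[tnth a i ^+ 2]real_normK ?num_real//.
    by rewrite expr2; ring.
  by rewrite -mulr_sumr -enorm_sqr expr2 mulrA mulfVK// gt_eqF.
have : \sum_(i < d) theta i <= \sum_(i < d) g.
  apply: ler_sum => i _; rewrite /theta ler_pdivrMr// ler_wpM2l//.
  exact: normr_tnth_le_enorm.
rewrite sumr_const card_ord -mulr_natr => /(ler_wpM2l rho0); lra.
Qed.

(** The box starts at [a] and extends away from the origin: on the line, a path
    from the origin that enters it has crossed [a]; in higher dimension it lies in
    the ball around [a] when [h] is small. *)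
Definition outward_box a (h : R) : set (d.-tuple R) :=
  [set y | forall i, 0 <= orthant_sign a i * (tnth y i - tnth a i) <= h].

Lemma measurable_outward_box a h : measurable (outward_box a h).
Proof.
apply: (@measurable_tuple_box R d
  (fun i => [set z | 0 <= orthant_sign a i * (z - tnth a i) <= h])) => i.
have mf : measurable_fun setT (fun z : R => orthant_sign a i * (z - tnth a i)).
  by apply: measurable_funM => //; exact: measurable_funB.
rewrite (_ : [set z | _] =
    [set z | 0 <= orthant_sign a i * (z - tnth a i)] `&`
    [set z | orthant_sign a i * (z - tnth a i) <= h]).
  by apply: measurableI; exact: measurable_set_le.
by apply/seteqP; split=> z /= => [/andP|[z0 zh]] //; apply/andP.
Qed.

Lemma bm_outward_box_ge (h u M : R) a :
    0 < h -> 0 < u -> enorm a <= M ->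
  (((h * normal_peak (Num.sqrt (D * u))) ^+ d *
     expR (- (M + h * d%:R) ^+ 2 / (D * u * 2)))%:E <=
   P (W u @^-1` outward_box a h))%E.
Proof.
move=> h0 u0 aM.
have Du0 : 0 < D * u by rewrite mulr_gt0.
have s2 : Num.sqrt (D * u) ^+ 2 = D * u by rewrite sqr_sqrtr// ltW.
have s0 : Num.sqrt (D * u) != 0 by rewrite gt_eqF ?sqrtr_gt0.
pose A i := [set z : R | 0 <= orthant_sign a i * (z - tnth a i) <= h].
have AE i : A i = `[(if 0 <= tnth a i then tnth a i else tnth a i - h),
                    (if 0 <= tnth a i then tnth a i else tnth a i - h) + h]%classic.
  rewrite /A /orthant_sign; apply/seteqP.
  by case: ifPn => _; split=> z; rewrite /= in_itv/= => /andP[? ?]; apply/andP; split; lra.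
have mA i : measurable (A i) by rewrite AE.
have -> : P (W u @^-1` outward_box a h) =
    (\prod_(i < d) normal_prob 0 (Num.sqrt (D * u)) (A i))%E.
  have := bm_gaussian_increments bmW (lexx 0) u0 mA; rewrite subr0 => <-.
  congr (P _); apply/seteqP; split=> w /= Hw i; move: (Hw i);
    by rewrite /A/= tnth_esub (bm_start bmW) tnth_mktuple subr0.
pose low i := h * (normal_peak (Num.sqrt (D * u)) *
  expR (- (`|tnth a i| + h) ^+ 2 / (D * u * 2))).
apply: (@le_trans _ _ (\prod_(i < d) (low i)%:E)%E); last first.
  apply: le_prode => i.
    by rewrite lee_fin !mulr_ge0 ?expR_ge0 ?normal_peak_ge0// ltW.
  have key c : `|c| <= `|tnth a i| + h -> `|c + h| <= `|tnth a i| + h ->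
      ((low i)%:E <= normal_prob 0 (Num.sqrt (D * u)) `[c, (c + h)%R])%E.
    move=> c1 c2; have cch : c <= c + h by rewrite lerDl ltW.
    have := normal_prob_itv_ge s0 cch c1 c2.
    by rewrite /low s2 (_ : c + h - c = h) // addrAC subrr add0r.
  rewrite AE; case: ifPn => [a0|]; last rewrite -ltNge => a0; apply: key.
  - by rewrite lerDl ltW.
  - by rewrite !ger0_norm// addr_ge0// ltW.
  - rewrite (ltr0_norm a0) ltr0_norm; first by rewrite opprB addrC.
    by rewrite subr_lt0 (lt_trans a0).
  - by rewrite subrK lerDl ltW.
rewrite prodEFin lee_fin /low; under eq_bigr do rewrite mulrA.
rewrite big_split/= prodr_const card_ord ler_wpM2l//.
  by rewrite exprn_ge0// mulr_ge0 ?normal_peak_ge0// ltW.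
rewrite -expR_sum ler_expR -mulr_suml ler_wpM2r//.
  by rewrite invr_ge0 mulr_ge0// ltW.
rewrite sumrN lerN2.
under eq_bigr do rewrite sqrrD real_normK ?num_real// -mulrnAl -mulr_natr -mulrA.
rewrite !big_split/= -mulr_suml -enorm_sqr sumr_const card_ord.
have M0 : 0 <= M by apply: le_trans aM; exact: enorm_ge0.
have aM2 : enorm a ^+ 2 <= M ^+ 2 by rewrite lerXn2r ?nnegrE ?enorm_ge0.
have sM : \sum_(i < d) `|tnth a i| <= M * d%:R.
  rewrite -[d in leRHS]card_ord mulr_natr -sumr_const; apply: ler_sum => i _.
  exact: le_trans (normr_tnth_le_enorm a i) aM.
have dd2 : d%:R <= d%:R ^+ 2 :> R.
  by rewrite -natrX ler_nat; case: (d) => // n; rewrite -[leqLHS]expn1 leq_pexp2l.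
rewrite -mulr_natr.
have := ler_wpM2l (ltW h0) sM; have := ler_wpM2l (sqr_ge0 h) dd2.
rewrite -[h ^+ 2 *+ d]mulr_natr.
have -> : (M + h * d%:R) ^+ 2 = M ^+ 2 + 2 * (h * (M * d%:R)) + h ^+ 2 * d%:R ^+ 2.
  by ring.
have -> : (\sum_(i < d) `|tnth a i|) * (1 * 2 * h) = 2 * (h * \sum_(i < d) `|tnth a i|).
  by ring.
lra.
Qed.

End brownian_estimates.

(** * Continuous paths and closed targets *)

Section paths.
Context {R : realType} {d : nat}.
Implicit Types (a : d.-tuple R) (p : R -> d.-tuple R) (f : R -> R).

Definition continuous_path p :=
  forall i, {within `[0, +oo[, continuous (fun t => tnth (p t) i)}.

Lemma within_continuousP f : {within `[0, +oo[, continuous f} <->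
  forall u, 0 <= u -> forall e, 0 < e ->
    exists2 delta, 0 < delta &
      forall s, 0 <= s -> `|s - u| < delta -> `|f s - f u| < e.
Proof.
rewrite subspace_continuousP; split=> [cf u u0 e e0|cf u].
  have /cvgrPdist_lt/(_ e e0) : f s @[s --> within `[0, +oo[ (nbhs u)] --> f u.
    by apply: cf; rewrite /= in_itv/= u0.
  rewrite near_withinE => -[delta /= delta0 H]; exists delta => // s s0 su.
  rewrite distrC; apply: H; last by rewrite in_itv/= s0.
  by rewrite /ball_/= distrC.
rewrite /= in_itv/= andbT => u0; apply/cvgrPdist_lt => e e0.
have [delta delta0 H] := cf u u0 e e0.
rewrite near_withinE; exists delta => //= s; rewrite /ball_/= distrC => su.
by rewrite in_itv/= andbT => s0; rewrite distrC; exact: H.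
Qed.

Lemma cvg_sumr (I T : Type) (F : set_system T) {FF : Filter F} (r : seq I)
    (g : I -> T -> R) (l : I -> R) : (forall i, g i x @[x --> F] --> l i) ->
  (\sum_(i <- r) g i x) @[x --> F] --> \sum_(i <- r) l i.
Proof.
move=> gl; elim: r => [|i r IH].
  by rewrite big_nil; under eq_fun do rewrite big_nil; exact: (cvg_cst (0 : R)).
rewrite big_cons; under eq_fun do rewrite big_cons.
exact: (@cvgD _ R^o _ _ _ _ _ _ _ (gl i) IH).
Qed.

Lemma continuous_distance a p : continuous_path p ->
  {within `[0, +oo[, continuous (fun s => enorm (esub (p s) a))}.
Proof.
move=> cp; rewrite (_ : (fun s => _) =
    Num.sqrt \o fun s => \sum_(i < d) (tnth (p s) i - tnth a i) ^+ 2); last first.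
  apply/funext => s /=; congr Num.sqrt.
  by apply: eq_bigr => i _; rewrite tnth_esub.
apply/subspace_continuousP => x Ax.
pose g s := \sum_(i < d) (tnth (p s) i - tnth a i) ^+ 2.
apply: (@cvg_comp _ _ _ g Num.sqrt _ (nbhs (g x))); last exact: sqrt_continuous.
apply: cvg_sumr => i.
apply: (@cvg_comp _ _ _ (fun s => tnth (p s) i - tnth a i) (fun y : R => y ^+ 2)
  _ (nbhs (tnth (p x) i - tnth a i))); last exact: exprn_continuous.
apply: cvgB; last exact: cvg_cst.
by have /subspace_continuousP := cp i; apply.
Qed.

(** The slack 1 in the level absorbs, by continuity, the distance from [u] to a
    grid point. *)
Lemma dyadic_grid_hit f (u v rho : R) : {within `[0, +oo[, continuous f} ->
    0 <= u -> u < v -> f u <= rho ->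
  exists m, exists2 j, (j < 2 ^ m)%N & f (v * j%:R / 2 ^+ m) <= rho + 1.
Proof.
move=> /within_continuousP cf u0 uv fu.
have [delta delta0 H] := cf u u0 1 ltr01.
have v0 : 0 < v by rewrite (le_lt_trans u0).
have [m Hm] : exists m : nat, v / 2 ^+ m < delta.
  exists (Num.truncn (v / delta)).+1.
  rewrite ltr_pdivrMr ?exprn_gt0// mulrC -ltr_pdivrMr//.
  apply: (@lt_le_trans _ _ (Num.truncn (v / delta)).+1%:R).
    exact: truncnS_gt.
  by rewrite -natrX ler_nat ltnW// ltn_expl.
have w0 : 0 <= u / v * 2 ^+ m by rewrite mulr_ge0 ?exprn_ge0// divr_ge0// ltW.
exists m, (Num.truncn (u / v * 2 ^+ m)).
  rewrite -(ltr_nat R); apply: (@le_lt_trans _ _ (u / v * 2 ^+ m)).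
    by rewrite truncn_le.
  by rewrite natrX gtr_pMl ?exprn_gt0// ltr_pdivrMr// mul1r.
set j := Num.truncn _.
have jle : j%:R <= u / v * 2 ^+ m by rewrite truncn_le.
have jgt : u / v * 2 ^+ m < j%:R + 1 by rewrite natr1 truncnS_gt.
have m0 : 0 < (2 : R) ^+ m by rewrite exprn_gt0.
have -> : v * j%:R / 2 ^+ m = v / 2 ^+ m * j%:R by rewrite mulrAC.
have uE : u = v / 2 ^+ m * (u / v * 2 ^+ m) by field; rewrite !gt_eqF.
have k0 : 0 < v / 2 ^+ m by rewrite divr_gt0.
have /H/(_ _) : 0 <= v / 2 ^+ m * j%:R by rewrite mulr_ge0// ltW.
have : `|v / 2 ^+ m * j%:R - u| < delta.
  rewrite uE -mulrBr normrM gtr0_norm// (le_lt_trans _ Hm)//.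
  by rewrite ler_piMr ?(ltW k0)// ler_norml; apply/andP; split; lra.
by move=> /[swap] /[apply]; rewrite ltr_norml => /andP[]; lra.
Qed.

(** A continuous function attains its minimum up to time [V], so that it cannot
    come arbitrarily close to a level that it does not reach. The right-hand side
    involves countably many times only, which makes hitting events measurable. *)
Lemma sublevel_hitP f (V rho : R) : {within `[0, +oo[, continuous f} ->
  (exists u, [/\ 0 <= u, u <= V & f u <= rho]) <->
  0 <= V /\ forall n : nat, exists q : rat,
    [/\ 0 <= ratr q :> R, ratr q < V + n.+1%:R^-1 & f (ratr q) < rho + n.+1%:R^-1].
Proof.
move=> /[dup] cf /within_continuousP ecf; split.
  move=> [u [u0 uV fu]]; split=> [|n]; first exact: le_trans uV.
  have : 0 < n.+1%:R^-1 :> R by rewrite invr_gt0.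
  move: (n.+1%:R^-1) => eta n0.
  have [delta delta0 H] := ecf u u0 _ n0.
  have [|q] := @rat_in_itvoo R u (u + Num.min delta eta).
    by rewrite ltrDl lt_min delta0.
  rewrite in_itv/= => /andP[uq quv]; exists q; move: (ratr q) uq quv => x uq quv.
  have q0 : 0 <= x by rewrite (le_trans u0)// ltW.
  have qd : x < u + delta by rewrite (lt_le_trans quv)// lerD2l ge_min lexx.
  have qn : x < u + eta.
    by rewrite (lt_le_trans quv)// lerD2l ge_min lexx orbT.
  split=> //; first by rewrite (lt_le_trans qn)// lerD2r.
  have /H/(_ _) : 0 <= x by [].
  have : `|x - u| < delta by rewrite gtr0_norm ?subr_gt0// ltrBlDl.
  by move=> /[swap] /[apply]; rewrite ltr_norml => /andP[]; lra.
move=> [V0 Hq]; apply: contrapT => nohit.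
have cfV : {within `[0, V], continuous f}.
  by apply: continuous_subspaceW cf => s /=; rewrite !in_itv/= andbT => /andP[].
have [c cV cmin] := EVT_min V0 cfV.
have fc : rho < f c.
  rewrite ltNge; apply/negP => fc; apply: nohit; exists c.
  by move: cV; rewrite in_itv/= => /andP[].
have fV : rho < f V.
  by rewrite (lt_le_trans fc)// cmin// in_itv/= V0 lexx.
(* The margin over the target is at least f c - rho up to time V, and at least
   half of f V - rho shortly after V. *)
have e2 : 0 < (f V - rho) / 2 by rewrite divr_gt0 ?subr_gt0.
have [delta2 delta20 H2] := ecf V V0 _ e2.
pose m := Num.min delta2 (Num.min (f c - rho) ((f V - rho) / 2)).
have m0 : 0 < m by rewrite !lt_min delta20 subr_gt0 fc e2.
have [n nm] : exists n : nat, n.+1%:R^-1 < m.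
  exists (Num.truncn m^-1); rewrite -[ltRHS]invrK ltf_pV2 ?posrE ?invr_gt0//.
  exact: truncnS_gt.
have [q [q0 qV fq]] := Hq n; move: (ratr q) (n.+1%:R^-1) nm q0 qV fq => x eta nm x0 xV fx.
have md : m <= delta2 by rewrite ge_min lexx.
have mc : m <= f c - rho by rewrite !ge_min lexx orbT.
have mV : m <= (f V - rho) / 2 by rewrite !ge_min lexx !orbT.
have [xleV|Vx] := leP x V.
  by have := cmin x; rewrite in_itv/= x0 xleV => /(_ isT); lra.
have /H2/(_ _) : 0 <= x :> R by [].
have : `|x - V| < delta2 by rewrite gtr0_norm ?subr_gt0//; lra.
by move=> /[swap] /[apply]; rewrite ltr_norml => /andP[]; lra.
Qed.

End paths.

(** * Hitting events and Brownian motion stopped by an exponential clock *)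

Section hitting_events.
Context {R : realType} {dd : measure_display} {Omega : measurableType dd}.
Context {d : nat}.
Variable W : R -> Omega -> d.-tuple R.
Hypothesis mW : forall t, 0 <= t -> measurable_fun setT (W t).
Hypothesis cW : forall w, continuous_path (W ^~ w).
Variables (a : d.-tuple R) (rho : R).

Lemma measurable_hit_by (V : Omega -> R) : measurable_fun setT V ->
  measurable [set w | exists u, [/\ 0 <= u, u <= V w &
    enorm (esub (W u w) a) <= rho]].
Proof.
move=> mV.
pose F n (q : rat) : set Omega := if 0 <= ratr q :> R then
    [set w | ratr q < V w + n.+1%:R^-1] `&`
    [set w | enorm (esub (W (ratr q) w) a) < rho + n.+1%:R^-1] else set0.
rewrite (_ : [set w | _] = [set w | 0 <= V w] `&` \bigcap_n \bigcup_q F n q).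
  apply: measurableI; first exact: measurable_set_le.
  apply: bigcapT_measurable => n; apply: bigcupT_measurable_rat => q.
  rewrite /F; case: ifPn => // q0; apply: measurableI.
    by apply: measurable_set_lt => //; exact: measurable_funD.
  apply: measurable_set_lt => //.
  exact: measurableT_comp (measurable_enorm_esub a) (mW q0).
apply/seteqP; split=> w /=.
  move=> /(sublevel_hitP _ _ (continuous_distance (a := a) (@cW w)))[V0 H].
  split=> // n _; have [q [q0 qV fq]] := H n.
  by exists q => //; rewrite /F q0.
move=> [V0 H]; apply/(sublevel_hitP _ _ (continuous_distance (a := a) (@cW w))).
split=> // n; have [q _] := H n I; rewrite /F; case: ifPn => // q0 [qV fq].
by exists q.
Qed.

Lemma measurable_hit_before (T : Omega -> R) : measurable_fun setT T ->
  measurable [set w | exists u, [/\ 0 <= u, u < T w &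
    enorm (esub (W u w) a) <= rho]].
Proof.
move=> mT.
rewrite (_ : [set w | _] = \bigcup_(q : rat) ([set w | ratr q < T w] `&`
    [set w | exists u, [/\ 0 <= u, u <= ratr q & enorm (esub (W u w) a) <= rho]])).
  apply: bigcupT_measurable_rat => q; apply: measurableI.
    exact: measurable_set_lt.
  exact: (measurable_hit_by (V := fun=> ratr q)).
apply/seteqP; split=> w /=.
  move=> [u [u0 uT hu]]; have [q] := rat_in_itvoo uT.
  rewrite in_itv/= => /andP[uq qT]; exists q => //; split=> //.
  by exists u; split=> //; exact: ltW.
move=> [q _ [qT [u [u0 uq hu]]]]; exists u; split=> //.
exact: le_lt_trans qT.
Qed.

End hitting_events.

Lemma bm_path {R : realType} {dd : measure_display} {Omega : measurableType dd}
    {P : probability Omega R} {d : nat} {D : R} {x : d.-tuple R}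
    {W : R -> Omega -> d.-tuple R} :
  brownian_motion P D x W -> forall w, continuous_path (W ^~ w).
Proof. by move=> bmW w i; exact: bm_continuous bmW w i. Qed.
Arguments bm_path {R dd Omega P d D x W} bmW w.

Section killed_brownian_motion.
Context {R : realType} {dd : measure_display} {Omega : measurableType dd}.
Variable P : probability Omega R.
Context {d : nat}.
Variables (D r : R) (W : R -> Omega -> d.-tuple R) (T : Omega -> R).
Hypothesis D_gt0 : 0 < D.
Hypothesis bmW : brownian_motion P D eorigin W.
Hypothesis clockT : exponential_clock P r T.
Hypothesis indWT : independent2 P (sigma_process `[0, +oo[ W) (sigma_variable T).
Implicit Types a : d.-tuple R.

Lemma measurable_clock : measurable_fun setT T.
Proof. by case: clockT. Qed.

Lemma clock_gt (x : R) : 0 < x -> P [set w | x < T w] = (expR (- r * x))%:E.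
Proof.
move=> x0; case: clockT => mT T0 lawT.
rewrite (_ : [set w | _] = ~` (T @^-1` `[0, x])).
  rewrite probability_setC.
    rewrite lawT// exponential_prob_itv0c//.
    by rewrite -[1%E]/((1 : R)%:E) -!EFinB subKr.
  by rewrite -[X in measurable X]setTI; exact: mT.
apply/seteqP; split=> w /=; rewrite in_itv/= T0/=; first by rewrite leNgt => ->.
by move=> /negP; rewrite -ltNge.
Qed.

Lemma clock_gt_le (x : R) : 0 <= x -> (P [set w | (x < T w)%R] <= (expR (- r * x))%:E)%E.
Proof.
rewrite le_eqVlt => /predU1P[<-|/clock_gt -> //].
rewrite mulr0 expR0; apply: probability_le1.
by apply: measurable_set_lt => //; exact: measurable_clock.
Qed.

(** The constant of [bm_grid_hit_le] for the radius [rho + 1], times the sum of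
    the geometric series over the unit intervals in which the clock may ring. *)
Definition killed_hit_const (g rho : R) : R :=
  expR (g * (rho + 1) * d%:R) / half_line_bound ^+ d * expR (g ^+ 2 * D / 2) /
  (1 - expR (g ^+ 2 * D / 2 - r)).

(** Each time interval [n < T <= n + 1] of the clock contributes at most
    exp (- r n) times the probability to be near [a] before time [n + 1], which
    grows like exp (g ^ 2 D n / 2); the condition on [g] makes the series
    geometric. *)
Lemma killed_hit_le (g rho : R) a :
    0 <= g -> g ^+ 2 * D / 2 < r -> 0 <= rho -> 0 < enorm a ->
  (P [set w | exists u, [/\ 0 <= u, u < T w & enorm (esub (W u w) a) <= rho]]%R <=
   (killed_hit_const g rho * expR (- g * enorm a))%:E)%E.
Proof.
move=> g0 gr rho0 a0.
have mT := measurable_clock.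
pose B := [set y : d.-tuple R | enorm (esub y a) <= rho + 1].
have mB : measurable B.
  by apply: measurable_set_le => //; exact: measurable_enorm_esub.
pose t (n m j : nat) : R := n.+1%:R * j%:R / 2 ^+ m.
have t0 n m j : 0 <= t n m j by rewrite divr_ge0// ?mulr_ge0// exprn_ge0.
have ndt n m : {homo t n m : j k / (j <= k)%N >-> j <= k}.
  move=> j k jk; rewrite /t ler_wpM2r ?invr_ge0 ?exprn_ge0//.
  by rewrite ler_wpM2l// ler_nat.
have tv n m j : (j < 2 ^ m)%N -> t n m j < n.+1%:R.
  move=> jm; rewrite /t -mulrA gtr_pMr// ltr_pdivrMr ?exprn_gt0// mul1r.
  by rewrite -natrX ltr_nat.
pose E n m := \big[setU/set0]_(j < 2 ^ m) (W (t n m j) @^-1` B).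
pose S (n : nat) := [set w | n%:R < T w] `&` [set w | T w <= n.+1%:R].
pose F n := \bigcup_m (E n m `&` S n).
have mWB n m j : measurable (W (t n m j) @^-1` B).
  exact: (measurable_bm_event bmW).
have mE n m : measurable (E n m) by apply: bigsetU_measurable => j _; exact: mWB.
have mS n : measurable (S n).
  by apply: measurableI; [exact: measurable_set_lt|exact: measurable_set_le].
have mF n : measurable (F n).
  by apply: bigcupT_measurable => m; exact: measurableI.
have mK := measurable_hit_before (bm_measurable bmW) (bm_path bmW) a rho mT.
apply: (@le_trans _ _ (P (\bigcup_n F n))).
  apply: le_measure; rewrite ?inE//; first exact: bigcupT_measurable.
  move=> w [u [u0 uT hu]] /=.
  have T0 : 0 < T w by exact: le_lt_trans uT.
  have [n nT] : exists n : nat, n%:R < T w <= n.+1%:R.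
    have /andP[kT Tk] := truncn_itv (ltW T0).
    have [Tk'|Tk'] := ltP (Num.truncn (T w))%:R (T w).
      by exists (Num.truncn (T w)); rewrite Tk' ltW.
    case: (Num.truncn (T w)) kT Tk Tk' => [|k] kT Tk Tk'.
      by have := lt_le_trans T0 Tk'; rewrite ltxx.
    by exists k; rewrite Tk' andbT (lt_le_trans _ kT)// ltr_nat.
  move: nT => /andP[nT Tn].
  have [m [j jm fj]] := dyadic_grid_hit
    (continuous_distance (a := a) (bm_path bmW w)) u0 (lt_le_trans uT Tn) hu.
  exists n => //; exists m => //; split=> //.
  rewrite /E -(bigcup_mkord (2 ^ m) (fun j => W (t n m j) @^-1` B)).
  by exists j.
pose A := expR (g * (rho + 1) * d%:R) / half_line_bound ^+ d *
  expR (g ^+ 2 * D / 2) * expR (- g * enorm a).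
rewrite (_ : _ * expR (- g * enorm a) = A / (1 - expR (g ^+ 2 * D / 2 - r))); last first.
  by rewrite /killed_hit_const mulrAC.
have hlb0 : 0 < (@half_line_bound R) ^+ d by rewrite exprn_gt0// half_line_bound_gt0.
apply: probability_bigcup_geometric_le => //.
- by rewrite !mulr_ge0 ?expR_ge0// invr_ge0 ltW.
- by rewrite expR_gt0 expR_lt1 subr_lt0.
move=> n; apply: probability_bigcup_nondecreasing_le.
- by move=> m; exact: measurableI.
- apply/nondecreasing_seqP => m; apply/subsetPset; apply: setSI.
  have EE k : E n k = \bigcup_(j < 2 ^ k) (W (t n k j) @^-1` B).
    by rewrite bigcup_mkord.
  rewrite !EE => w [j /= jm Bj]; exists (2 * j)%N.
    by rewrite /= expnS ltn_pmul2l.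
  suff <- : t n m j = t n m.+1 (2 * j)%N by [].
  by rewrite /t natrM exprS; field; rewrite expf_neq0.
- move=> m; rewrite (_ : P (E n m `&` S n) = (P (E n m) * P (S n))%E); last first.
    apply: indWT.
      apply: (sigma_algebra_bigsetU (F := fun j => W (t n m j) @^-1` B)) => j.
      apply: sigma_process_event => //=.
      by rewrite in_itv/= t0.
    exists (`]n%:R, n.+1%:R]%classic) => //; rewrite setTI.
    by apply/seteqP; split=> w /=; rewrite in_itv/= => /andP.
  apply: (@le_trans _ _ ((expR (g * (rho + 1) * d%:R) / half_line_bound ^+ d *
      expR (- g * enorm a + g ^+ 2 * D * n.+1%:R / 2))%:E *
      (expR (- r * n%:R))%:E)%E).
    apply: lee_pmul => //.
      by apply: (bm_grid_hit_le D_gt0 bmW) => //; [rewrite addr_ge0|exact: tv].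
    apply: le_trans (clock_gt_le (ler0n _ n)).
    apply: le_measure; rewrite ?inE//; last exact: subIsetl.
    exact: measurable_set_lt.
  rewrite -EFinM lee_fin /A -expRM_natr.
  rewrite -!mulrA ler_wpM2l ?expR_ge0// ler_wpM2l ?invr_ge0 ?(ltW hlb0)//.
  rewrite -!expRD ler_expR -natr1; lra.
Qed.

End killed_brownian_motion.

(** * Independent events and the target *)

Section independent_events.
Context {R : realType} {dd : measure_display} {Omega : measurableType dd}.
Variable P : probability Omega R.

(** By induction on the number of complements in a mixed intersection: removing
    one more event from a set S is the difference P S - P (S `&` A). *)
Lemma independent_setC (A : nat -> set Omega) (p : nat -> R) (n : nat) :
    (forall k, measurable (A k)) ->
    (forall J : seq nat, uniq J ->
      P (\bigcap_(k in [set` J]) A k) = (\prod_(k <- J) p k)%:E) ->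
  P (\bigcap_(k < n) ~` A k) = (\prod_(k < n) (1 - p k))%:E.
Proof.
move=> mA indA.
have mJ (J : seq nat) : measurable (\bigcap_(k in [set` J]) A k).
  by apply: fin_bigcap_measurable => //; exact: finite_seq.
have mC m : measurable (\bigcap_(k < m) ~` A k).
  apply: fin_bigcap_measurable => [|k _]; first exact: finite_II.
  exact: measurableC.
have main m : forall J : seq nat, uniq J -> (forall k, k \in J -> (m <= k)%N) ->
    P (\bigcap_(k < m) ~` A k `&` \bigcap_(k in [set` J]) A k) =
    (\prod_(k < m) (1 - p k) * \prod_(k <- J) p k)%:E.
  elim: m => [J uJ _|m IH J uJ mJle].
    rewrite big_ord0 mul1r -indA//; congr (P _).
    by rewrite bigcap_mkord big_ord0 setTI.
  have JN : m \notin J by apply/negP => /mJle; rewrite ltnn.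
  have IH1 := IH J uJ (fun k kJ => ltnW (mJle k kJ)).
  have := IH (m :: J); rewrite /= JN uJ => /(_ isT) IH2.
  have {}IH2 := IH2 _; rewrite big_ord_recr/=.
  set S := \bigcap_(k < m) ~` A k `&` \bigcap_(k in [set` J]) A k in IH1.
  have -> : \bigcap_(k < m.+1) ~` A k `&` \bigcap_(k in [set` J]) A k = S `\` A m.
    apply/seteqP; split=> w.
      move=> [H HJ]; split; last exact: (H m (ltnSn m)).
      by split=> // k km; apply: H; exact: ltnW.
    move=> [[H HJ] Hm]; split=> // k.
    by rewrite /= ltnS leq_eqVlt => /orP[/eqP ->//|]; exact: H.
  have SA : S `&` A m =
      \bigcap_(k < m) ~` A k `&` \bigcap_(k in [set` m :: J]) A k.
    rewrite /S -setIA; congr (_ `&` _); apply/seteqP; split=> w /=.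
      by move=> [HJ Hm] k /=; rewrite inE => /orP[/eqP ->|/HJ].
    move=> H; split=> [k kJ|]; apply: H => /=; rewrite inE ?eqxx//.
    by rewrite kJ orbT.
  have mS : measurable S by exact: measurableI.
  have -> : P (S `\` A m) = (P S - P (S `&` A m))%E.
    by apply: measureD => //; rewrite ltey_eq fin_num_measure.
  rewrite SA IH1 IH2; last first.
    by move=> k; rewrite inE => /orP[/eqP ->//|/mJle/ltnW].
  by rewrite big_cons -EFinB; congr EFin; ring.
have := main n [::] isT; rewrite big_nil mulr1 => <- //.
by congr (P _); apply/seteqP; split=> [w Hw|w []].
Qed.

End independent_events.

Section location_target.
Context {R : realType}.

Definition target_radius (eps0 : R) (d : nat) : R := if d == 1%N then 0 else eps0.

(** A point is a closed ball of radius 0, so that both cases of the target can be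
    treated at once. *)
Lemma location_targetE (d : nat) (eps0 : R) (a y : d.-tuple R) :
  location_target eps0 a y <-> enorm (esub y a) <= target_radius eps0 d.
Proof.
rewrite /location_target /target_radius; case: ifPn => //= _.
split=> [->|].
  rewrite /enorm (_ : \sum_(i < d) _ = 0) ?sqrtr0// big1// => i _.
  by rewrite tnth_esub subrr expr0n.
move=> ya; apply: eq_from_tnth => i; apply/eqP; rewrite -subr_eq0 -tnth_esub.
rewrite -normr_eq0 eq_le normr_ge0 andbT.
exact: le_trans (normr_tnth_le_enorm _ i) ya.
Qed.

(** On the line this is the intermediate value theorem. *)
Lemma outward_box_hit (d : nat) (eps0 u : R) (a : d.-tuple R)
    (p : R -> d.-tuple R) :
    (0 < d)%N -> 0 <= eps0 -> continuous_path p -> p 0 = eorigin -> 0 <= u ->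
    outward_box a (eps0 / d%:R) (p u) ->
  exists2 s, 0 <= s <= u & location_target eps0 a (p s).
Proof.
move=> d0 e0 cp p0 u0 pu; have [d1|d1] := eqVneq d 1%N.
  subst d; have cpu : {within `[0, u], continuous (fun t => tnth (p t) ord0)}.
    by apply: continuous_subspaceW (cp ord0) => s /=; rewrite !in_itv/= andbT => /andP[].
  have [|s s0u sa] := IVT u0 cpu (v := tnth a ord0).
    rewrite p0 tnth_mktuple ge_min le_max; have /andP[] := pu ord0.
    case: (orthant_signP a ord0) (orthant_signE a ord0) => -> aE ya1 _;
      have := normr_ge0 (tnth a ord0); rewrite -aE => a0;
      by apply/andP; split; apply/orP; [left + right; lra|left + right; lra].
  exists s => //; rewrite /location_target/=; apply: eq_from_tnth => i.
  by rewrite (ord1 i).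
exists u; first by rewrite u0 lexx.
apply/location_targetE; rewrite /target_radius (negbTE d1).
rewrite -(ger0_norm e0) -sqrtr_sqr ler_sqrt ?sqr_ge0//.
apply: (@le_trans _ _ (\sum_(i < d) (eps0 / d%:R) ^+ 2)).
  apply: ler_sum => i _; rewrite tnth_esub.
  have /andP[ya1 ya2] := pu i.
  have -> : (tnth (p u) i - tnth a i) ^+ 2 =
      (orthant_sign a i * (tnth (p u) i - tnth a i)) ^+ 2.
    by rewrite exprMn orthant_sign_sqr mul1r.
  by rewrite lerXn2r ?nnegrE ?divr_ge0.
have dR0 : 0 < d%:R :> R by rewrite ltr0n.
rewrite sumr_const card_ord -[leLHS]mulr_natr.
have -> : (eps0 / d%:R) ^+ 2 * d%:R = eps0 ^+ 2 / d%:R by field; rewrite gt_eqF.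
by rewrite ler_pdivrMr// ler_peMr ?sqr_ge0// ler1n.
Qed.

End location_target.

(** * Survival of the process with resetting *)

Section resetting_survival.
Context {R : realType} {dd : measure_display} {Omega : measurableType dd}.
Variable P : probability Omega R.
Context {d : nat}.
Variables (D r eps0 : R) (X : R -> Omega -> d.-tuple R).
Variables (W : nat -> R -> Omega -> d.-tuple R) (T : nat -> Omega -> R).
Hypotheses (D_gt0 : 0 < D) (eps0_gt0 : 0 < eps0).
Hypothesis d_gt0 : (0 < d)%N.
Hypothesis bmW : forall k, brownian_motion P D eorigin (W k).
Hypothesis clockT : forall k, exponential_clock P r (T k).
Hypothesis indWT : mutually_independent P (fun j : nat + nat =>
  match j with
  | inl k => sigma_process `[0, +oo[ (W k)
  | inr k => sigma_variable (T k)
  end).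
Hypothesis resets_locally_finite : forall w t, 0 <= t ->
  exists k, reset_time T k w <= t < reset_time T k.+1 w.
Hypothesis X_cycle : forall w t k, reset_time T k w <= t < reset_time T k.+1 w ->
  X t w = W k (t - reset_time T k w) w.
Implicit Types a : d.-tuple R.

Let rho := target_radius eps0 d.

Let rho_ge0 : 0 <= rho.
Proof. by rewrite /rho /target_radius; case: ifP => // _; exact: ltW. Qed.

Let mT k : measurable_fun setT (T k).
Proof. by case: (clockT k). Qed.

Let T_ge0 k w : 0 <= T k w.
Proof. by case: (clockT k). Qed.

Lemma reset_timeS k w : reset_time T k.+1 w = reset_time T k w + T k w.
Proof. by rewrite /reset_time big_ord_recr. Qed.

Lemma le_reset_time w : {homo (fun k => reset_time T k w) : m n / (m <= n)%N >-> m <= n}.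
Proof.
by apply: (@homo_leq R) => [x||k]; [exact: lexx|exact: le_trans|rewrite reset_timeS lerDl].
Qed.

Lemma reset_time_ge0 k w : 0 <= reset_time T k w.
Proof. by rewrite sumr_ge0. Qed.

Lemma measurable_reset_time k : measurable_fun setT (reset_time T k).
Proof. exact: measurable_sum. Qed.

Lemma cycle_independent k :
  independent2 P (sigma_process `[0, +oo[ (W k)) (sigma_variable (T k)).
Proof.
move=> A B WA TB.
have := indWT (J := [:: inl k; inr k])
  (A := fun j => match j with inl _ => A | inr _ => B end) isT.
rewrite !big_cons big_nil mule1 => <-; last first.
  by move=> j; rewrite !inE => /orP[] /eqP ->.
congr (P _); apply/seteqP; split=> w /=.
  by move=> [Aw Bw] j /=; rewrite !inE => /orP[] /eqP ->.
by move=> H; split; [apply: (H (inl k))|apply: (H (inr k))];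
  rewrite /= !inE eqxx ?orbT.
Qed.

(** Independence of the motions and clocks is regrouped by cycles. *)
Lemma cycle_events_independent (E C : nat -> set Omega) (J : seq nat) :
    (forall k, sigma_process `[0, +oo[ (W k) (E k)) ->
    (forall k, sigma_variable (T k) (C k)) -> uniq J ->
  P (\bigcap_(k in [set` J]) (E k `&` C k)) = (\prod_(k <- J) P (E k `&` C k))%E.
Proof.
move=> WE TC uJ.
pose F j := match j with inl k => E k | inr k => C k end.
have := indWT (J := map inl J ++ map inr J) (A := F).
rewrite cat_uniq !map_inj_uniq ?uJ/= ?andbT; [|exact: inr_inj|exact: inl_inj].
have -> : ~~ has [in map inl J] (map (@inr nat nat) J).
  by apply/hasPn => _ /mapP[k _ ->]; apply/negP => /mapP[].
move=> /(_ isT) indF; transitivity (P (\bigcap_(j in [set` map inl J ++ map inr J]) F j)).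
  congr (P _); apply/seteqP; split=> w /=.
    move=> H j /=; rewrite mem_cat => /orP[] /mapP[k kJ ->];
      by have [] := H k kJ.
  move=> H k kJ; split; first by apply: (H (inl k)); rewrite /= mem_cat map_f.
  by apply: (H (inr k)); rewrite /= mem_cat [X in _ || X]map_f// orbT.
rewrite indF; last by case=> k _ /=.
rewrite big_cat/= !big_map -big_split/=; apply: eq_bigr => k _.
by rewrite (cycle_independent (WE k) (TC k)).
Qed.

(** The infimum defining the location time is attained: the target is closed
    and the paths are right-continuous. *)
Lemma location_time_gtP a w (t : R) : 0 <= t ->
  (t%:E < location_time eps0 a (X ^~ w))%E <->
  ~ exists k u, [/\ 0 <= u, u < T k w, reset_time T k w + u <= t &
                 enorm (esub (W k u w) a) <= rho].
Proof.
move=> t0; split.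
  move=> tlt [k [u [u0 uT ut hu]]]; move: tlt; rewrite ltNge => /negP; apply.
  apply: (@le_trans _ _ (reset_time T k w + u)%:E); last by rewrite lee_fin.
  apply: ereal_inf_lbound; exists (reset_time T k w + u) => //; split.
    by rewrite addr_ge0// reset_time_ge0.
  have := @X_cycle w (reset_time T k w + u) k.
  rewrite lerDl u0 reset_timeS ltrD2l uT => /(_ isT) ->.
  by rewrite addrAC subrr add0r; apply/location_targetE.
move=> nohit; have [k /andP[kt tk]] := resets_locally_finite w t0.
have u0 : 0 <= t - reset_time T k w by rewrite subr_ge0.
have ft : rho < enorm (esub (W k (t - reset_time T k w) w) a).
  rewrite ltNge; apply/negP => ft; apply: nohit.
  exists k, (t - reset_time T k w); split=> //.
    by rewrite ltrBlDl -reset_timeS.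
  by rewrite addrC subrK.
have := continuous_distance (a := a) (bm_path (bmW k) w).
move/within_continuousP => /(_ _ u0 (enorm (esub (W k (t - reset_time T k w) w) a) - rho)).
rewrite subr_gt0 => /(_ ft)[delta delta0 H].
pose delta' := Num.min delta (reset_time T k.+1 w - t).
have delta'0 : 0 < delta' by rewrite lt_min delta0 subr_gt0.
apply: (@lt_le_trans _ _ (t + delta')%:E); first by rewrite lte_fin ltrDl.
apply: le_ereal_inf_tmp => _ [s [s0 hs] <-]; rewrite lee_fin leNgt; apply/negP => st.
have [sle|tlts] := leP s t.
  have [j /andP[js sj]] := resets_locally_finite w s0; apply: nohit.
  exists j, (s - reset_time T j w); split; first by rewrite subr_ge0.
  - by rewrite ltrBlDl -reset_timeS.
  - by rewrite addrC subrK.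
  - by move: hs; rewrite (@X_cycle w s j) ?js// => /location_targetE.
have sd : s < t + delta by rewrite (lt_le_trans st)// lerD2l ge_min lexx.
have sk : s < reset_time T k.+1 w.
  rewrite (lt_le_trans st)// -lerBrDl ge_min lexx orbT//.
have ks : reset_time T k w <= s by rewrite (le_trans kt)// ltW.
move: hs; rewrite (@X_cycle w s k) ?ks// => /location_targetE.
have /H/(_ _) : 0 <= s - reset_time T k w by rewrite subr_ge0.
have -> : s - reset_time T k w - (t - reset_time T k w) = s - t by ring.
have : `|s - t| < delta by rewrite gtr0_norm ?subr_gt0//; lra.
by move=> /[swap] /[apply]; rewrite ltr_norml -/rho => /andP[]; lra.
Qed.

Lemma measurable_survival a (t : R) : 0 <= t ->
  measurable [set w | (t%:E < location_time eps0 a (X ^~ w))%E].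
Proof.
move=> t0; rewrite (_ : [set w | _] = ~` \bigcup_k
   ([set w | exists u, [/\ 0 <= u, u < T k w & enorm (esub (W k u w) a) <= rho]] `&`
    [set w | exists u, [/\ 0 <= u, u <= t - reset_time T k w &
                        enorm (esub (W k u w) a) <= rho]])).
  apply: measurableC; apply: bigcupT_measurable => k; apply: measurableI.
    exact: (measurable_hit_before (bm_measurable (bmW k)) (bm_path (bmW k))).
  apply: (measurable_hit_by (bm_measurable (bmW k)) (bm_path (bmW k))).
  by apply: measurable_funB => //; exact: measurable_reset_time.
apply/seteqP; split=> w /=.
  move/(location_time_gtP _ _ t0) => nohit [k _ [[u [u0 uT hu]] [v [v0 vt hv]]]].
  (* the earlier of the two hits meets both deadlines *)
  apply: nohit; exists k; have [uv|vu] := leP u v.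
    by exists u; split=> //; rewrite -lerBrDl (le_trans uv).
  by exists v; split=> //; [exact: lt_trans uT|rewrite -lerBrDl].
move=> nohit; apply/(location_time_gtP _ _ t0) => -[k [u [u0 uT ut hu]]].
apply: nohit; exists k => //; split; exists u; split=> //.
by rewrite lerBrDl.
Qed.

(** A lower bound for the probability that the target is hit before the clock
    rings: the clock outlasts time [u], at which the motion is beyond the
    target. *)
Definition cycle_hit_bound (u M : R) : R :=
  (eps0 / d%:R * normal_peak (Num.sqrt (D * u))) ^+ d *
  expR (- (M + eps0 / d%:R * d%:R) ^+ 2 / (D * u * 2)) * expR (- r * u).

(** To survive until [t], either one of the first [N] cycles is longer than
    [t / N], or the first [N] cycles all miss the target and end before [t]. *)
Lemma survival_le a (u M t : R) (N : nat) :
    0 < u -> enorm a <= M -> 0 < t -> (0 < N)%N ->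
  (P [set w | (t%:E < location_time eps0 a (X ^~ w))%E] <=
   (N%:R * expR (- r * (t / N%:R)) + expR (- cycle_hit_bound u M * N%:R))%:E)%E.
Proof.
move=> u0 aM t0 N0.
have h0 : 0 < eps0 / d%:R by rewrite divr_gt0// ltr0n.
pose E k := W k u @^-1` outward_box a (eps0 / d%:R).
pose C k := [set w | u < T k w].
pose A k := E k `&` C k.
have mE k : measurable (E k).
  by apply: (measurable_bm_event (bmW k)); [exact: ltW|exact: measurable_outward_box].
have mC k : measurable (C k) by exact: measurable_set_lt.
have mA k : measurable (A k) by exact: measurableI.
have WE k : sigma_process `[0, +oo[ (W k) (E k).
  apply: sigma_process_event; last exact: measurable_outward_box.
  by rewrite /= in_itv/= ltW.
have TC k : sigma_variable (T k) (C k).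
  exists (`]u, +oo[%classic) => //; rewrite setTI.
  by apply/seteqP; split=> w /=; rewrite in_itv/= andbT.
pose p k := fine (P (A k)).
have PA k : P (A k) = (p k)%:E by rewrite fineK// fin_num_measure.
have pq k : cycle_hit_bound u M <= p k.
  rewrite -lee_fin -PA (cycle_independent (WE k) (TC k)).
  rewrite (clock_gt (clockT k) u0) /cycle_hit_bound EFinM.
  apply: lee_wpmul2r; first by rewrite lee_fin expR_ge0.
  exact: (bm_outward_box_ge D_gt0 (bmW k)).
have p1 k : p k <= 1 by rewrite -lee_fin -PA probability_le1.
pose V := \bigcap_(k < N) ~` A k.
have mV : measurable V.
  apply: fin_bigcap_measurable => [|k _]; first exact: finite_II.
  exact: measurableC.
have PV : (P V <= (expR (- cycle_hit_bound u M * N%:R))%:E)%E.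
  rewrite (independent_setC N mA (p := p)); last first.
    move=> J uJ; rewrite cycle_events_independent// -prodEFin.
    by apply: eq_bigr => k _; rewrite -PA.
  rewrite lee_fin (expRM_natr N) -[N in leRHS]card_ord -prodr_const.
  apply: ler_prod => k _; rewrite subr_ge0 p1/=.
  by apply: le_trans (expR_ge1Dx _); rewrite lerD2l lerN2 pq.
pose U := \big[setU/set0]_(k < N) [set w | t / N%:R < T k w].
have mU k : measurable [set w | t / N%:R < T k w] by exact: measurable_set_lt.
have PU : (P U <= (N%:R * expR (- r * (t / N%:R)))%:E)%E.
  apply: (probability_bigsetU_le _ mU) => k; apply: (clock_gt_le (clockT k)).
  by rewrite divr_ge0// ltW.
rewrite EFinD; apply: le_trans (leeD PU PV).
have mUU : measurable U by apply: bigsetU_measurable.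
apply: le_trans (measureU2 P mUU mV).
apply: le_measure; rewrite ?inE; first by apply: measurable_survival; exact: ltW.
  exact: measurableU.
move=> w /= /(location_time_gtP _ _ (ltW t0)) nohit.
have [[k [kN Tk]]|short] := pselect (exists k, (k < N)%N /\ t / N%:R < T k w).
  by left; rewrite /U -(bigcup_mkord N (fun k => [set w | t / N%:R < T k w])); exists k.
right => k /= kN -[Ek uT]; apply: nohit.
have [s /andP[s0 su] hs] := outward_box_hit d_gt0 (ltW eps0_gt0)
  (bm_path (bmW k) w) (bm_start (bmW k) w) (ltW u0) Ek.
exists k, s; split=> //; first exact: le_lt_trans uT.
  apply: (@le_trans _ _ (reset_time T k.+1 w)).
    by rewrite reset_timeS lerD2l (le_trans su)// ltW.
  apply: (@le_trans _ _ (\sum_(j < N) t / N%:R)).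
    apply: le_trans (le_reset_time w kN) _; apply: ler_sum => j _.
    by rewrite leNgt; apply/negP => Tj; apply: short; exists j.
  by rewrite sumr_const card_ord -[leLHS]mulr_natr divfK// pnatr_eq0 -lt0n.
exact/location_targetE.
Qed.

Lemma reset_time_block k j K w : (j < K)%N ->
  reset_time T k w + T (k + j)%N w <= reset_time T (k + K)%N w.
Proof.
move=> jK; apply: (@le_trans _ _ (reset_time T (k + j).+1 w)).
  by rewrite reset_timeS lerD2r; exact/le_reset_time/leq_addr.
by apply: le_reset_time; rewrite -addnS leq_add2l.
Qed.

(** If each of [m] blocks of [K] cycles contains a cycle longer than 1, then
    the resets of these blocks take longer than [m]. *)
Lemma reset_time_early_le (m K : nat) (t : R) : t < m%:R ->
  (P [set w | (reset_time T (m * K) w <= t)%R] <=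
   (m%:R * (1 - expR (- r)) ^+ K)%:E)%E.
Proof.
move=> tm.
pose Z k := [set w | T k w <= 1].
have mZ k : measurable (Z k) by exact: measurable_set_le.
have PZ k : P (Z k) = (1 - expR (- r))%:E.
  have -> : Z k = ~` [set w | 1 < T k w].
    by apply/seteqP; split=> w /=; rewrite /Z/= leNgt => /negP.
  rewrite probability_setC ?(clock_gt (clockT k))// ?mulr1//.
  exact: measurable_set_lt.
pose Y (i : nat) := \bigcap_(k in [set` iota (i * K)%N K]) Z k.
have mY i : measurable (Y i) by apply: fin_bigcap_measurable => //; exact: finite_seq.
have PY i : P (Y i) = ((1 - expR (- r)) ^+ K)%:E.
  have := @cycle_events_independent (fun=> setT) Z (iota (i * K)%N K).
  have -> : (fun k => [set: Omega] `&` Z k) = Z by apply/funext => k; rewrite setTI.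
  rewrite /Y => ->; last exact: iota_uniq.
  - under eq_bigr do rewrite setTI PZ.
    by rewrite prodEFin big_const_seq count_predT size_iota iter_mulr_1.
  - move=> k; rewrite -setC0; apply: (@sigma_algebraC Omega).
    exact: sigma_algebra0.
  - move=> k; exists (`]-oo, 1]%classic) => //; rewrite setTI.
    by apply/seteqP; split=> w /=; rewrite in_itv.
apply: (@le_trans _ _ (P (\big[setU/set0]_(i < m) Y i))).
  apply: le_measure; rewrite ?inE.
  - by apply: measurable_set_le => //; exact: measurable_reset_time.
  - exact: bigsetU_measurable.
  move=> w /= Sle; rewrite -(bigcup_mkord m Y); apply: contrapT => noY.
  suff main i : (i <= m)%N -> i%:R <= reset_time T (i * K) w.
    by have := main m (leqnn m); rewrite leNgt (le_lt_trans Sle).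
  elim: i => [_|i IH im]; first by rewrite reset_time_ge0.
  have [j jK Tj] : exists2 j, (j < K)%N & 1 < T (i * K + j)%N w.
    apply: contrapT => noj; apply: noY; exists i => // k /=.
    rewrite mem_iota => /andP[ik ki]; rewrite /Z/= leNgt; apply/negP => Tk.
    apply: noj; exists (k - i * K)%N; last by rewrite subnKC.
    by rewrite ltn_subLR.
  rewrite mulSn addnC -natr1.
  have := reset_time_block (i * K) w jK; have := IH (ltnW im); lra.
by apply: (probability_bigsetU_le _ mY) => i; rewrite PY.
Qed.

(** To be hit before [t], the target has to be hit in one of the first
    [m * K] cycles, unless these end before [t]. *)
Lemma hit_le a (g t : R) (m K : nat) :
    0 <= g -> g ^+ 2 * D / 2 < r -> 0 < enorm a -> 0 <= t -> t < m%:R ->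
  (P (~` [set w | (t%:E < location_time eps0 a (X ^~ w))%E]) <=
   (m%:R * (1 - expR (- r)) ^+ K +
    (m * K)%:R * (killed_hit_const D r (d := d) g rho * expR (- g * enorm a)))%:E)%E.
Proof.
move=> g0 gr a0 t0 tm.
pose H k := [set w | exists u, [/\ 0 <= u, u < T k w & enorm (esub (W k u w) a) <= rho]].
have mH k : measurable (H k).
  exact: (measurable_hit_before (bm_measurable (bmW k)) (bm_path (bmW k))).
have mS : measurable [set w | reset_time T (m * K) w <= t].
  by apply: measurable_set_le => //; exact: measurable_reset_time.
rewrite EFinD; apply: (@le_trans _ _ (P [set w | (reset_time T (m * K) w <= t)%R] +
  P (\big[setU/set0]_(k < m * K) H k))%E).
  have mHH : measurable (\big[setU/set0]_(k < m * K) H k).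
    exact: bigsetU_measurable.
  apply: le_trans (measureU2 P mS mHH).
  apply: le_measure; rewrite ?inE.
  - by apply: measurableC; exact: measurable_survival.
  - exact: measurableU.
  move=> w /= nosurv; apply: contrapT => nothere; apply: nosurv.
  apply/(location_time_gtP a w t0) => -[k [u [u0 uT ut hu]]]; apply: nothere.
  have [kN|Nk] := ltnP k (m * K); last first.
    left => /=; apply: le_trans ut; apply: (le_trans (le_reset_time w Nk)).
    by rewrite lerDl.
  by right; rewrite -(bigcup_mkord (m * K) H); exists k => //; exists u.
apply: leeD; first exact: reset_time_early_le.
apply: (probability_bigsetU_le _ mH) => k.
exact: (killed_hit_le D_gt0 (bmW k) (clockT k) (@cycle_independent k)).
Qed.

End resetting_survival.

(** * Lebesgue measure on tuples and stretched exponentials *)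

Section lebesgue_products.
Context {R : realType}.

Lemma lebesgue_tuple_box (n : nat) (A : 'I_n -> set R) :
    (forall i, measurable (A i)) ->
  lebesgue_tuple n [set x : n.-tuple R | forall i, A i (tnth x i)] =
  (\prod_(i < n) lebesgue_measure (A i))%E.
Proof.
elim: n A => [|n IH] A mA /=.
  rewrite big_ord0 diracE (_ : _ \in _ = true) //.
  by apply/mem_set => -[].
rewrite big_ord_recl -(IH (fun i => A (lift ord0 i)))//.
rewrite /lebesgue_tuple_step /pushforward -product_measure1E//.
  congr (_ _); apply/seteqP; split=> -[x v] /=.
    move=> H; split; first by have := H ord0; rewrite tnth0.
    by move=> i; have := H (lift ord0 i); rewrite tnthS.
  move=> [Ax Av] i; case: (unliftP ord0 i) => [j|] ->; rewrite ?tnthS ?tnth0//.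
  exact: mA.
by apply: (@measurable_tuple_box R n (fun i => A (lift ord0 i))).
Qed.

Lemma integral_lebesgue_tuple_prod (n : nat) (h : R -> R) (c : R) :
    measurable_fun setT h -> (forall x, 0 <= h x) ->
    (\int[lebesgue_measure]_x (h x)%:E = c%:E)%E ->
  (\int[lebesgue_tuple n]_x (\prod_(i < n) h (tnth x i))%:E = (c ^+ n)%:E)%E.
Proof.
move=> mh h0 hc.
have c0 : 0 <= c.
  by rewrite -lee_fin -hc integral_ge0// => x _; rewrite lee_fin.
(* measurableTypeR R is R with the same measurable sets under another name. *)
pose lam : {sigma_finite_measure set (measurableTypeR R) -> \bar R} :=
  @lebesgue_measure R.
elim: n => [|n IH] /=.
  under eq_integral do rewrite big_ord0.
  by rewrite integral_cst//= diracT mule1.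
pose F (x : n.+1.-tuple R) := (\prod_(i < n.+1) h (tnth x i))%:E.
have mprod m : measurable_fun setT
    (fun x : m.-tuple R => (\prod_(i < m) h (tnth x i))%:E).
  apply/measurable_EFinP; apply: measurable_prod => i _.
  exact: measurableT_comp (measurable_tnth i).
transitivity (\int[(lam \x lebesgue_tuple n)%E]_z F (tuple_cons z))%E.
  have F0 : {in setT, forall y, (0 <= F y)%E}.
    by move=> y _; rewrite lee_fin prodr_ge0.
  have mcons : measurable_fun setT
      (@tuple_cons R n : measurableTypeR R * n.-tuple R -> _).
    exact: measurable_tuple_cons.
  have := ge0_integral_pushforward mcons
    (lam \x lebesgue_tuple n)%E measurableT (mprod n.+1) F0.
  rewrite preimage_setT => <-.
  exact: eq_measure_integral.
rewrite fubini_tonelli1//; last 2 first.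
- apply: measurableT_comp; first exact: mprod.
  exact: measurable_tuple_cons.
- by move=> z; rewrite lee_fin prodr_ge0.
transitivity (\int[lam]_x ((h x)%:E * (c ^+ n)%:E))%E.
  apply: eq_integral => x _; rewrite /fubini_F -IH.
  rewrite -ge0_integralZl//; last 3 first.
  - exact: mprod.
  - by move=> y _; rewrite lee_fin prodr_ge0.
  - by rewrite lee_fin.
  apply: eq_integral => y _; rewrite /F -EFinM big_ord_recl tnth0.
  by congr (_ * _)%:E; apply: eq_bigr => i _; rewrite tnthS.
have mhE : measurable_fun setT (fun x : measurableTypeR R => (h x)%:E).
  exact/measurable_EFinP.
have hE0 : forall x : measurableTypeR R, setT x -> (0 <= (h x)%:E)%E.
  by move=> x _; rewrite lee_fin.
have := @ge0_integralZr _ _ R lam setT measurableT _ mhE (c ^+ n)%:E hE0.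
rewrite lee_fin exprn_ge0// => /(_ isT) ->.
by rewrite [X in (X * _)%E]hc -EFinM exprS.
Qed.

Lemma integral_oneDsqrV :
  (\int[lebesgue_measure]_x ((oneDsqr (x : R))^-1)%:E = pi%:E)%E.
Proof.
rewrite ge0_symfun_integralT//=.
- rewrite (_ : [set x | _] = `[0, +oo[%classic); last first.
    by apply/seteqP; split => x/=; rewrite in_itv/= andbT.
  by rewrite integral0y_oneDsqr -EFinM mulrCA divff// mulr1.
- exact: continuous_oneDsqrV.
- by move=> x /=; rewrite /oneDsqr sqrrN.
Qed.

End lebesgue_products.

Section stretched_exponential.
Context {R : realType}.
Implicit Types (c l x : R).

Lemma powR_half_sqr x l : 0 <= x -> (x `^ (l / 2)) ^+ 2 = x `^ l.
Proof.
by move=> x0; rewrite -powR_mulrn ?powR_ge0// -powRrM divfK.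
Qed.

Lemma ln_le_powR x p : 0 < x -> 0 < p -> ln x <= x `^ p / p.
Proof.
move=> x0 p0; rewrite ler_pdivlMr// mulrC -ln_powR.
by apply/ltW/ln_sublinear; rewrite powR_gt0.
Qed.

(** The logarithm of 1 + x^2 is, up to a constant, at most of the order of x^(l / 2), whose square
    x^l absorbs it: complete the square. *)
Lemma poly_le_stretched_exponential (c l : R) (d : nat) : 0 < c -> 0 < l ->
  exists2 K, 0 < K & forall x, 0 <= x -> (1 + x ^+ 2) ^+ d <= K * expR (c * x `^ l).
Proof.
move=> c0 l0.
(* What is left after completing the square, and the case x < 1. *)
pose A := 4 / l; exists (expR (d%:R * 2 + (d%:R * A) ^+ 2 / (4 * c))).
  exact: expR_gt0.
move=> x x0; have x20 : 0 < 1 + x ^+ 2 by rewrite ltr_pwDl// sqr_ge0.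
rewrite -expRD -[X in X ^+ d](lnK x20) -expRM_natr ler_expR mulrC.
have lnle : ln (1 + x ^+ 2) <= 2 + A * x `^ (l / 2).
  have [x1|x1] := ltP x 1.
    apply: (@le_trans _ _ (x ^+ 2)).
      by apply: le_ln1Dx; rewrite (lt_le_trans (@ltrN10 R))// sqr_ge0.
    apply: (@le_trans _ _ 1).
      by rewrite exprn_ile1// ltW.
    have : 0 <= A * x `^ (l / 2) by rewrite mulr_ge0 ?powR_ge0// divr_ge0// ltW.
    lra.
  have xgt0 : 0 < x by rewrite (lt_le_trans ltr01).
  apply: (@le_trans _ _ (ln (2 * x ^+ 2))).
    rewrite ler_ln ?posrE// ?mulr_gt0 ?exprn_gt0//.
    by have : 1 <= x ^+ 2 by [rewrite exprn_ege1|]; lra.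
  rewrite lnM ?posrE ?exprn_gt0// lnXn//.
  have two0 : 0 < 2 :> R by [].
  have := ln_sublinear two0.
  have := ln_le_powR xgt0 (divr_gt0 l0 two0).
  rewrite (_ : x `^ (l / 2) / (l / 2) = A / 2 * x `^ (l / 2)); last first.
    by rewrite /A; field; rewrite gt_eqF.
  rewrite -mulr_natr; lra.
have := ler_wpM2l (ler0n R d) lnle; rewrite -(powR_half_sqr l x0).
set y := x `^ (l / 2).
have : 0 <= (2 * c * y - d%:R * A) ^+ 2 / (4 * c).
  by rewrite divr_ge0 ?sqr_ge0// mulr_ge0// ltW.
rewrite (_ : (2 * c * y - d%:R * A) ^+ 2 / (4 * c) =
    c * y ^+ 2 - d%:R * A * y + (d%:R * A) ^+ 2 / (4 * c)).
  move: (_ / (4 * c)) => Q; lra.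
by field; rewrite gt_eqF.
Qed.

End stretched_exponential.

(** * Mass of the complement of a ball *)

Section outside_ball.
Context {R : realType} {d : nat}.

Definition outside_ball (M : R) : set (d.-tuple R) := [set a | M < enorm a].

Lemma measurable_outside_ball M : measurable (outside_ball M).
Proof. by apply: measurable_set_lt => //; exact: measurable_enorm. Qed.

End outside_ball.

Section tails.
Context {R : realType} {d : nat}.
Variables (B l : R) (mu : probability (d.-tuple R) R) (f : d.-tuple R -> R).
Hypotheses (B_gt0 : 0 < B) (l_gt0 : 0 < l) (d_gt0 : (0 < d)%N).
Hypothesis mu_density : has_density mu f.
Hypothesis f_tail :
  (lne (f a)%:E / (enorm a `^ l)%:E)%E @[a --> einfty] --> (- B)%:E.

Lemma enorm_le_sum (x : d.-tuple R) : enorm x <= \sum_(i < d) `|tnth x i|.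
Proof.
have s0 : 0 <= \sum_(i < d) `|tnth x i| by rewrite sumr_ge0.
rewrite -(ger0_norm s0) -sqrtr_sqr ler_sqrt ?sqr_ge0//.
rewrite expr2 mulr_suml; apply: ler_sum => i _.
rewrite -real_normK ?num_real// expr2 ler_wpM2l//.
by rewrite (bigD1 i)//= lerDl sumr_ge0.
Qed.

Lemma density_tail (eta : R) : 0 < eta ->
  exists2 M0, 1 <= M0 & forall a : d.-tuple R, M0 < enorm a ->
    expR (- (B + eta) * enorm a `^ l) <= f a <= expR (- (B - eta) * enorm a `^ l).
Proof.
move=> eta0; have /fine_cvgP[[M1 _ Hfin] /cvgrPdist_lt/(_ _ eta0)[M2 _ Hdist]] := f_tail.
exists (Num.max 1 (Num.max M1 M2)); first by rewrite le_max lexx.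
move=> a; rewrite !gt_max => /and3P[a1 aM1 aM2].
have := Hfin a aM1; have := Hdist a aM2 => /=.
have al0 : 0 < enorm a `^ l by rewrite powR_gt0// (lt_trans ltr01).
rewrite inver gt_eqF//; case: ifPn => fa; first by rewrite mulNyr gtr0_sg ?invr_gt0// mul1e.
rewrite -ltNge in fa; rewrite /= => + _.
rewrite -opprD normrN ltr_norml addrC => /andP[lo up].
have lnE : expR (ln (f a)) = f a by rewrite lnK.
rewrite -lnE !ler_expR; apply/andP; split.
  by rewrite -ler_pdivlMr// -[leLHS]opprK; lra.
by rewrite -ler_pdivrMr//; lra.
Qed.

Let f_ge0 a : 0 <= f a. Proof. by case: mu_density. Qed.

Let mf : measurable_fun setT f. Proof. by case: mu_density. Qed.

Let muE A : measurable A -> mu A = (\int[lebesgue_tuple d]_(a in A) (f a)%:E)%E.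
Proof. by case: mu_density => _ _; apply. Qed.

(** The complement of a ball contains a unit cube all of whose points are at
    distance at most [M + d] from the origin. *)
Lemma outside_ball_mass_ge (eta : R) : 0 < eta ->
  exists2 M0, 0 <= M0 & forall M, M0 <= M ->
    ((expR (- (B + eta) * (M + d%:R) `^ l))%:E <= mu (outside_ball M))%E.
Proof.
move=> eta0; have [M0 M01 H] := density_tail eta0.
exists M0 => [|M M0M]; first exact: le_trans M01.
have M_ge0 : 0 <= M by rewrite (le_trans _ M0M)// (le_trans _ M01).
pose i0 : 'I_d := Ordinal d_gt0.
pose A (i : 'I_d) : set R := if i == i0 then `]M, (M + 1)%R]%classic else `[0, 1]%classic.
pose Q := [set a : d.-tuple R | forall i, A i (tnth a i)].
have mA i : measurable (A i) by rewrite /A; case: ifP.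
have mQ : measurable Q by exact: measurable_tuple_box.
have Q1 : lebesgue_tuple d Q = 1%E.
  rewrite lebesgue_tuple_box// big1// => i _; rewrite /A; case: ifP => _.
    rewrite (lebesgue_measure_itv `]M, (M + 1)%R]) /= lte_fin ltrDl ltr01.
    by rewrite -EFinB addrAC subrr add0r.
  by rewrite (lebesgue_measure_itv `[0, 1]) /= lte01 oppr0 adde0.
have Qlo a : Q a -> M < enorm a.
  move=> /(_ i0); rewrite /A eqxx /= in_itv/= => /andP[Ma _].
  by rewrite (lt_le_trans Ma)// (le_trans (ler_norm _))// normr_tnth_le_enorm.
have Qup a : Q a -> enorm a <= M + d%:R.
  move=> Qa; apply: le_trans (enorm_le_sum a) _.
  rewrite (bigD1 i0)//=; apply: (@le_trans _ _ (M + 1 + \sum_(i < d | i != i0) 1)).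
    apply: lerD.
      have := Qa i0; rewrite /A eqxx /= in_itv/= => /andP[Ma Ma1].
      by rewrite ger0_norm// ltW// (le_lt_trans M_ge0).
    apply: ler_sum => i ii0; have := Qa i; rewrite /A (negbTE ii0) /= in_itv/=.
    by move=> /andP[a0 a1]; rewrite ger0_norm.
  have -> : d%:R = \sum_(i < d) 1 :> R by rewrite sumr_const card_ord.
  by rewrite [in leRHS](bigD1 i0)//= addrA.
apply: (@le_trans _ _ (mu Q)); last first.
  by apply: le_measure; rewrite ?inE//; exact: measurable_outside_ball.
rewrite muE//.
apply: (@le_trans _ _ (\int[lebesgue_tuple d]_(a in Q)
    (expR (- (B + eta) * (M + d%:R) `^ l))%:E)%E).
  by rewrite integral_cst//= Q1 mule1.
apply: ge0_le_integral => //.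
  by apply/measurable_EFinP; exact: measurable_funTS.
move=> a Qa; rewrite lee_fin.
have /andP[+ _] := H a (le_lt_trans M0M (Qlo a Qa)); apply: le_trans.
rewrite ler_expR !mulNr lerN2 ler_wpM2l//; first by rewrite addr_ge0// ltW.
apply: ge0_ler_powR; rewrite ?nnegrE ?enorm_ge0 ?addr_ge0//; first exact: ltW.
exact: Qup.
Qed.

(** Half of [eta] is given up for integrability: exp (- (eta / 2) |a|^l) is
    dominated by a product of Cauchy densities. *)
Lemma outside_ball_mass_le (eta : R) : 0 < eta -> eta < B ->
  exists2 C, 0 < C & exists2 M0, 0 <= M0 & forall M, M0 <= M ->
    (mu (outside_ball M) <= (C * expR (- (B - eta) * M `^ l))%:E)%E.
Proof.
move=> eta0 etaB; have eta2 : 0 < eta / 2 by rewrite divr_gt0.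
have [M0 M01 H] := density_tail eta2.
have [K K0 HK] := poly_le_stretched_exponential d eta2 l_gt0.
exists (K * pi ^+ d); first by rewrite mulr_gt0// exprn_gt0// pi_gt0.
exists M0 => [|M M0M]; first exact: le_trans M01.
have M_ge0 : 0 <= M by rewrite (le_trans _ M0M)// (le_trans _ M01).
pose h (x : R) := (oneDsqr x)^-1.
have h0 x : 0 <= h x by rewrite invr_ge0 (le_trans ler01)// oneDsqr_ge1.
have mh : measurable_fun setT h.
  by apply: continuous_measurable_fun; exact: continuous_oneDsqrV.
have mprod : measurable_fun setT (fun a : d.-tuple R => \prod_(i < d) h (tnth a i)).
  apply: measurable_prod => i _; exact: measurableT_comp (measurable_tnth i).
pose c := K * expR (- (B - eta) * M `^ l).
have mcprod : measurable_fun setT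
    (EFin \o fun a : d.-tuple R => c * \prod_(i < d) h (tnth a i)).
  by apply/measurable_EFinP; exact: measurable_funM.
have c0 : 0 <= c by rewrite mulr_ge0 ?expR_ge0// ltW.
have mM := @measurable_outside_ball R d M.
rewrite muE//; apply: (@le_trans _ _ (\int[lebesgue_tuple d]_(a in outside_ball M)
    (c%:E * (\prod_(i < d) h (tnth a i))%:E))%E).
  apply: ge0_le_integral => //.
  - by move=> a _; rewrite lee_fin.
  - by apply/measurable_EFinP; exact: measurable_funTS.
  - apply/measurable_EFinP; apply: measurable_funM => //.
    exact: measurable_funTS.
  move=> a Ma; rewrite -EFinM lee_fin.
  have /andP[_ up] := H a (le_lt_trans M0M Ma); apply: (le_trans up).
  have Ml : M `^ l <= enorm a `^ l.
    by apply: ge0_ler_powR; rewrite ?nnegrE ?enorm_ge0// ltW.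
  apply: (@le_trans _ _ (expR (- (B - eta) * M `^ l) *
      expR (- (eta / 2 * enorm a `^ l)))).
    rewrite -expRD ler_expR.
    have BM : (B - eta) * M `^ l <= (B - eta) * enorm a `^ l.
      by rewrite ler_wpM2l// subr_ge0 ltW.
    lra.
  rewrite /c [K * _]mulrC -[leRHS]mulrA ler_wpM2l ?expR_ge0//.
  have -> : \prod_(i < d) h (tnth a i) = (\prod_(i < d) oneDsqr (tnth a i))^-1.
    by rewrite prodfV.
  have p0 : 0 < \prod_(i < d) oneDsqr (tnth a i).
    by apply: prodr_gt0 => i _; rewrite (lt_le_trans ltr01)// oneDsqr_ge1.
  rewrite (ler_pdivlMr _ _ p0) expRN [leLHS]mulrC (ler_pdivrMr _ _ (expR_gt0 _)).
  apply: le_trans (HK _ (enorm_ge0 a)).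
  rewrite (_ : (1 + enorm a ^+ 2) ^+ d = \prod_(i < d) (1 + enorm a ^+ 2)); last first.
    by rewrite prodr_const card_ord.
  apply: ler_prod => i _; rewrite (le_trans ler01) ?oneDsqr_ge1//= /oneDsqr lerD2l.
  rewrite -real_normK ?num_real// lerXn2r ?nnegrE ?enorm_ge0//.
  exact: normr_tnth_le_enorm.
apply: (@le_trans _ _ (\int[lebesgue_tuple d]_a
    (c%:E * (\prod_(i < d) h (tnth a i))%:E))%E).
  apply: ge0_subset_integral => //.
  by move=> a _; rewrite -EFinM lee_fin mulr_ge0// prodr_ge0.
have mprodE : measurable_fun setT
    (EFin \o fun a : d.-tuple R => \prod_(i < d) h (tnth a i)).
  exact/measurable_EFinP.
rewrite (ge0_integralZl _ measurableT mprodE); last 2 first.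
- by move=> a _; rewrite lee_fin prodr_ge0.
- by rewrite lee_fin.
rewrite (integral_lebesgue_tuple_prod d mh h0 integral_oneDsqrV).
by rewrite -EFinM lee_fin /c mulrAC.
Qed.

End tails.

(** * Growth comparisons *)

Section growth.
Context {R : realType}.
Implicit Types (c l s eps A : R).

Lemma expR_ge_threshold c eps : 0 < eps ->
  exists2 s0, 0 <= s0 & forall s, s0 <= s -> c <= expR (eps * s).
Proof.
move=> eps0; exists (`|c| / eps); first by rewrite divr_ge0// ltW.
move=> s; rewrite ler_pdivrMr// mulrC => cs.
apply: (le_trans (ler_norm c)); apply: (le_trans cs).
by apply: le_trans (expR_ge1Dx _); rewrite lerDr.
Qed.

Lemma powR_ge_threshold c l eta : 0 < l -> 0 < eta ->
  exists2 s0, 0 <= s0 & forall s, s0 <= s -> c <= eta * s `^ l.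
Proof.
move=> l0 eta0; exists ((`|c| / eta) `^ l^-1); first exact: powR_ge0.
move=> s cs; apply: (le_trans (ler_norm c)).
rewrite mulrC -ler_pdivrMr// -[leLHS]powRr1 ?divr_ge0 ?(ltW eta0)//.
rewrite -(mulVf (lt0r_neq0 l0)) powRrM.
have sge0 : 0 <= s by exact: le_trans (powR_ge0 _ _) cs.
by apply: ge0_ler_powR; rewrite ?nnegrE ?powR_ge0// ltW.
Qed.

Lemma sqr_le_expR eps : 0 < eps ->
  exists2 K, 0 < K & forall s, 0 <= s -> 1 + s ^+ 2 <= K * expR (eps * s).
Proof.
move=> eps0; have [K K0 H] := poly_le_stretched_exponential 1 eps0 (@ltr01 R).
by exists K => // s s0; have := H s s0; rewrite powRr1.
Qed.

Lemma powR_le_expR A c l eps : 0 <= A -> 0 < c -> 0 < eps ->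
  exists2 s0, 1 <= s0 & forall s, s0 <= s -> s + A * s `^ l <= c * expR (eps * s).
Proof.
move=> A0 c0 eps0; pose n := (Num.truncn `|l|).+1.
have e20 : 0 < eps / 2 by rewrite divr_gt0.
have [K K0 H] := poly_le_stretched_exponential n e20 (@ltr01 R).
have [s0 s00 Hs0] := expR_ge_threshold ((1 + A) * K / c) e20.
exists (Num.max 1 s0) => [|s]; first by rewrite le_max lexx.
rewrite ge_max => /andP[s1 s0s].
have sge0 : 0 <= s by rewrite (le_trans ler01).
have s2 : 1 <= 1 + s ^+ 2 by rewrite lerDl sqr_ge0.
have ss2 : s <= 1 + s ^+ 2.
  by have := sqr_ge0 (s - 1); rewrite sqrrB1; lra.
have s2n : s <= (1 + s ^+ 2) ^+ n by rewrite (le_trans ss2)// ler_eXnr.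
have sln : s `^ l <= (1 + s ^+ 2) ^+ n.
  apply: (@le_trans _ _ (s `^ n%:R)).
    apply: ler_powR => //; apply: (le_trans (ler_norm l)).
    by rewrite ltW// truncnS_gt.
  by rewrite powR_mulrn// lerXn2r// nnegrE (le_trans ler01).
have := H s sge0; rewrite powRr1// => Hs.
apply: (@le_trans _ _ ((1 + A) * (K * expR (eps / 2 * s)))).
  rewrite mulrDl mul1r; apply: lerD; first exact: le_trans Hs.
  by rewrite ler_wpM2l// (le_trans sln).
have -> : eps * s = eps / 2 * s + eps / 2 * s by field.
rewrite expRD [leLHS]mulrA [leRHS]mulrA ler_wpM2r ?expR_ge0//.
by have := Hs0 s s0s; rewrite ler_pdivrMr// [leRHS]mulrC.
Qed.

End growth.

(** * Survival until the time exp s *)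

Section survival_asymptotics.
Context {R : realType} {dd : measure_display} {Omega : measurableType dd}.
Variable P : probability Omega R.
Context {d : nat}.
Variables (D r eps0 : R) (X : R -> Omega -> d.-tuple R).
Hypotheses (D_gt0 : 0 < D) (r_gt0 : 0 < r) (eps0_gt0 : 0 < eps0).
Hypothesis d_gt0 : (0 < d)%N.
Hypothesis X_reset : resetting_brownian_motion P D r eorigin X.
Implicit Types (a : d.-tuple R) (delta s t : R).

Definition survival (t : R) a : set Omega :=
  [set w | (t%:E < location_time eps0 a (X ^~ w))%E].

(** For a process started at the origin the first cycle is like the others. *)
Lemma resetting_cycles : exists (W : nat -> R -> Omega -> d.-tuple R)
    (T : nat -> Omega -> R),
  [/\ forall k, brownian_motion P D eorigin (W k),
      forall k, exponential_clock P r (T k),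
      mutually_independent P (fun j : nat + nat =>
        match j with
        | inl k => sigma_process `[0, +oo[ (W k)
        | inr k => sigma_variable (T k)
        end),
      forall w t, 0 <= t ->
        exists k, reset_time T k w <= t < reset_time T k.+1 w &
      forall w t k, reset_time T k w <= t < reset_time T k.+1 w ->
        X t w = W k (t - reset_time T k w) w].
Proof.
have [W [T [bmW clockT indWT lf XW]]] := X_reset.
by exists W, T; split=> // k; have := bmW k; case: k.
Qed.

Lemma survival_measurable a t : 0 <= t -> measurable (survival t a).
Proof.
move=> t0; have [W [T [bmW clockT indWT lf XW]]] := resetting_cycles.
exact: (measurable_survival eps0 bmW clockT lf XW).
Qed.

(** The distance that the motion explores up to an exponential time of rate
    [r]: the target at [a] is hit in a cycle with probability about
    exp (- |a| / kappa). *)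
Definition kappa : R := Num.sqrt (D / (2 * r)).

Lemma kappa_gt0 : 0 < kappa.
Proof. by rewrite sqrtr_gt0 divr_gt0// mulr_gt0. Qed.

Lemma kappa_sqr : kappa ^+ 2 = D / (2 * r).
Proof. by rewrite sqr_sqrtr// divr_ge0 ?mulr_ge0 ?ltW. Qed.

(** The time [u] minimizes the sum of the Gaussian cost
    [(M + eps0) ^ 2 / (2 D u)] of the travel and of the cost [r u] of keeping
    the clock silent. *)
Lemma cycle_hit_bound_growth delta eps : 0 < delta -> delta < 1 -> 0 < eps ->
  exists2 c, 0 < c & forall s, 0 <= s -> exists2 u, 0 < u &
    c * expR (- (1 - delta + eps) * s) <=
    cycle_hit_bound (d := d) D r eps0 u ((1 - delta) * kappa * s).
Proof.
move=> delta0 delta1 e0; have k0 := kappa_gt0.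
pose h := eps0 / d%:R.
have h0 : 0 < h by rewrite divr_gt0// ltr0n.
have [K K0 HK] := poly_le_stretched_exponential d e0 (@ltr01 R).
pose A := 1 + 2 * pi * D * ((kappa + eps0) / (2 * r * kappa)).
have rk0 : 0 < 2 * r * kappa by rewrite !mulr_gt0.
have pi0 : 0 < pi :> R := pi_gt0 R.
have A0 : 0 < A.
  have q0 : 0 < (kappa + eps0) / (2 * r * kappa) by rewrite divr_gt0// addr_gt0.
  by rewrite addr_gt0// mulr_gt0// !mulr_gt0.
exists ((h / A) ^+ d / K * expR (- (eps0 / kappa))).
  by rewrite !mulr_gt0 ?expR_gt0 ?exprn_gt0 ?invr_gt0// divr_gt0.
move=> s s0; pose M := (1 - delta) * kappa * s.
have M0 : 0 <= M by rewrite !mulr_ge0// ?subr_ge0 ltW.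
have Me0 : 0 < M + eps0 by rewrite ltr_wpDl.
pose u := (M + eps0) / (2 * r * kappa).
have u0 : 0 < u by rewrite divr_gt0.
exists u => //; rewrite /cycle_hit_bound -/h -/M.
have hd : h * d%:R = eps0 by rewrite /h divfK// pnatr_eq0 -lt0n.
have Du0 : 0 < D * u by rewrite mulr_gt0.
rewrite hd -[leRHS]mulrA -expRD.
have -> : - (M + eps0) ^+ 2 / (D * u * 2) + - r * u = - (1 - delta) * s - eps0 / kappa.
  have -> : D = 2 * r * kappa ^+ 2 by rewrite kappa_sqr mulrC divfK// gt_eqF// mulr_gt0.
  rewrite /u; have -> : M = (1 - delta) * kappa * s by [].
  move: (gt_eqF k0) (gt_eqF r_gt0) (gt_eqF Me0); rewrite /M.
  by move=> kn rn Mn; field; rewrite kn rn Mn.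
have peak : (A * (1 + s ^+ 2))^-1 <= normal_peak (Num.sqrt (D * u)).
  have s21 : 1 <= 1 + s ^+ 2 by rewrite lerDl sqr_ge0.
  have ss2 : s <= 1 + s ^+ 2 by have := sqr_ge0 (s - 1); rewrite sqrrB1; lra.
  rewrite /normal_peak sqr_sqrtr ?(ltW Du0)// lef_pV2 ?posrE; last 2 first.
  - by rewrite mulr_gt0// (lt_le_trans ltr01).
  - by rewrite sqrtr_gt0 mulrn_wgt0// mulr_gt0.
  have x0 : 0 <= D * u * pi *+ 2 by rewrite mulrn_wge0// mulr_ge0 ?ltW.
  apply: (@le_trans _ _ (1 + D * u * pi *+ 2)).
    have y0 : 0 <= 1 + D * u * pi *+ 2 by rewrite addr_ge0.
    rewrite -[leRHS](ger0_norm y0) -sqrtr_sqr ler_sqrt ?sqr_ge0//.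
    by have := sqr_ge0 (D * u * pi *+ 2); move: x0; set x := _ *+ 2; rewrite expr2; nra.
  rewrite /A mulrDl mul1r; apply: lerD => //.
  rewrite -mulr_natr; have -> : D * u * pi * 2 = 2 * pi * D * u by ring.
  have pD0 : 0 <= 2 * pi * D by rewrite !mulr_ge0// ltW.
  rewrite -[leRHS]mulrA ler_wpM2l// /u [leRHS]mulrAC.
  rewrite ler_wpM2r ?invr_ge0 ?(ltW rk0)// [leRHS]mulrDl; apply: lerD.
    apply: (@le_trans _ _ (kappa * s)); last by rewrite ler_wpM2l// ltW.
    have ks0 : 0 <= kappa * s by rewrite mulr_ge0// ltW.
    by rewrite /M -mulrA ler_piMl//; lra.
  by rewrite ler_peMr// ltW.
have -> : (h / A) ^+ d / K * expR (- (eps0 / kappa)) * expR (- (1 - delta + eps) * s) =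
    (h / A) ^+ d / (K * expR (eps * s)) * expR (- (1 - delta) * s - eps0 / kappa).
  rewrite expRD (_ : - (1 - delta + eps) * s = - (1 - delta) * s - eps * s); last by ring.
  rewrite expRD !expRN; move: (expR_gt0 (eps * s)) (expR_gt0 (eps0 / kappa)) K0.
  move: (expR _) (expR _) (expR _) (_ ^+ d) => x1 x2 x3 x4 x10 x20 K00.
  by field; rewrite !gt_eqF.
rewrite ler_wpM2r ?expR_ge0//.
have Hs := HK s s0; rewrite powRr1// in Hs.
have p0 : 0 < 1 + s ^+ 2 by rewrite ltr_pwDl// sqr_ge0.
apply: (@le_trans _ _ ((h / A) ^+ d / (1 + s ^+ 2) ^+ d)).
  have hA0 : 0 <= (h / A) ^+ d by rewrite exprn_ge0// divr_ge0// ltW.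
  by rewrite ler_wpM2l// lef_pV2 ?posrE ?mulr_gt0 ?expR_gt0 ?exprn_gt0.
rewrite -expr_div_n lerXn2r ?nnegrE ?mulr_ge0 ?invr_ge0 ?normal_peak_ge0
  ?(ltW eps0_gt0) ?(ltW h0) ?(ltW A0) ?(ltW p0)//.
by rewrite -mulrA ler_wpM2l ?(ltW h0)// -invfM.
Qed.

(** Among N, about exp ((1 - eps) s), cycles there is none longer than
    exp s / N, about exp (eps s), and each of them hits the target with
    probability at least of order exp (- (1 - delta + eps) s); since eps is small compared
    with delta, both exceptional events have doubly exponentially small
    probability. *)
Lemma survival_near_le delta A l : 0 < delta -> delta < 1 -> 0 <= A ->
  exists2 s0, 1 <= s0 & forall s, s0 <= s ->
    forall a, enorm a <= (1 - delta) * kappa * s ->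
    (P (survival (expR s) a) <= (2 * expR (- (A * s `^ l)))%:E)%E.
Proof.
move=> delta0 delta1 A0; pose eps := delta / 4.
have e0 : 0 < eps by rewrite divr_gt0.
have [c c0 Hc] := cycle_hit_bound_growth delta0 delta1 e0.
have c20 : 0 < c / 2 by rewrite divr_gt0.
have [s1 s11 Hs1] := powR_le_expR l A0 r_gt0 e0.
have [s2 s21 Hs2] := powR_le_expR l A0 c20 e0.
exists (Num.max s1 s2) => [|s]; first by rewrite le_max s11.
rewrite ge_max => /andP[ss1 ss2] a aM.
have sge0 : 0 <= s by rewrite (le_trans _ ss1)// (le_trans _ s11).
have [u u0 Hu] := Hc s sge0.
have [W [T [bmW clockT indWT lf XW]]] := resetting_cycles.
pose y := expR ((1 - eps) * s).
have y1 : 1 <= y by rewrite -expR0 ler_expR mulr_ge0// subr_ge0 /eps; lra.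
have [N [N0 Ny yN]] : exists N : nat, [/\ (0 < N)%N, N%:R <= y & y < N%:R + 1].
  exists (Num.truncn y); rewrite truncn_gt0 truncn_le ?(le_trans ler01)//.
  by rewrite natr1 truncnS_gt.
have N0R : 0 < N%:R :> R by rewrite ltr0n.
have N1R : 1 <= N%:R :> R by rewrite ler1n.
have yE : y * expR (eps * s) = expR s by rewrite -expRD; congr expR; ring.
apply: (le_trans (survival_le D_gt0 eps0_gt0 d_gt0 bmW clockT indWT lf XW
  u0 aM (expR_gt0 s) N0)).
rewrite lee_fin [leRHS]mulr_natl [leRHS]mulr2n; apply: lerD.
  apply: (@le_trans _ _ (expR s * expR (- r * expR (eps * s)))).
    apply: ler_pM; rewrite ?expR_ge0//.
      by rewrite (le_trans Ny)// ler_expR ler_piMl// /eps; lra.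
    rewrite ler_expR !mulNr lerN2 ler_wpM2l ?(ltW r_gt0)//.
    by rewrite ler_pdivlMr// -yE mulrC ler_wpM2r ?expR_ge0.
  by rewrite -expRD ler_expR mulNr; have := Hs1 s ss1; lra.
rewrite ler_expR mulNr lerN2; apply: le_trans (_ : _ <= c / 2 * expR (eps * s)) _.
  by have := Hs2 s ss2; lra.
apply: (@le_trans _ _ (c * expR (- (1 - delta + eps) * s) * (y / 2))); last first.
  by apply: ler_pM => //; rewrite ?mulr_ge0 ?expR_ge0 ?ltW//; lra.
have -> : c * expR (- (1 - delta + eps) * s) * (y / 2) =
    c / 2 * expR (2 * eps * s).
  rewrite /y (_ : 2 * eps * s = - (1 - delta + eps) * s + (1 - eps) * s).
    by rewrite expRD; ring.
  by rewrite /eps; field.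
by rewrite ler_wpM2l ?(ltW c20)// ler_expR ler_wpM2r//; move: e0; lra.
Qed.

(** About exp s cycles, up to a factor s, are run until time exp s, and each of
    them hits the target with probability at most of order
    exp (- (1 + delta / 2) s). *)
Lemma survival_far_ge delta : 0 < delta ->
  exists2 s0, 0 <= s0 & forall s, s0 <= s ->
    forall a, (1 + delta) * kappa * s < enorm a ->
    (2^-1%:E <= P (survival (expR s) a))%E.
Proof.
have half (x y : R) : 1 - x <= y -> y <= 2^-1 -> 2^-1 <= x by lra.
move=> delta0; have k0 := kappa_gt0.
(* below 1 / kappa, but with g * ((1 + delta) * kappa) above 1 *)
pose g := (1 + delta / 2) / (1 + delta) / kappa.
have d10 : 0 < 1 + delta by rewrite addr_gt0.
have g0 : 0 <= g.
  by rewrite !divr_ge0 ?(ltW k0) ?(ltW d10)// addr_ge0// divr_ge0// ltW.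
have gr : g ^+ 2 * D / 2 < r.
  have -> : D = 2 * r * kappa ^+ 2 by rewrite kappa_sqr mulrC divfK// gt_eqF// mulr_gt0.
  have -> : g ^+ 2 * (2 * r * kappa ^+ 2) / 2 = ((1 + delta / 2) / (1 + delta)) ^+ 2 * r.
    by rewrite /g; field; rewrite !gt_eqF.
  rewrite gtr_pMl// expr_lt1 ?divr_ge0 ?(ltW d10)//; last by rewrite addr_ge0// divr_ge0// ltW.
  by rewrite ltr_pdivrMr// mul1r; lra.
pose b := - ln (1 - expR (- r)).
have beta0 : 0 < 1 - expR (- r) by rewrite subr_gt0 expR_lt1 oppr_lt0.
have b0 : 0 < b by rewrite oppr_gt0 ln_lt0// beta0 gtrBl expR_gt0.
pose C := killed_hit_const (d := d) D r g (target_radius eps0 d).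
have C0 : 0 <= C.
  have hlb0 : 0 < (@half_line_bound R) ^+ d by rewrite exprn_gt0// half_line_bound_gt0.
  rewrite /C /killed_hit_const !divr_ge0 ?mulr_ge0 ?expR_ge0 ?invr_ge0 ?(ltW hlb0)//.
  by rewrite subr_ge0 expR_le1 subr_le0 ltW.
have e0 : 0 < delta / 4 by rewrite divr_gt0.
have [K1 K10 HK1] := sqr_le_expR e0.
pose A1 := 9 / b + 1.
have A10 : 0 < A1 by rewrite addr_gt0// divr_gt0.
have [s1 s10 Hs1] := expR_ge_threshold (8 * (A1 * C * K1)) e0.
exists s1 => // s ss1 a aM; have s0 : 0 <= s by rewrite (le_trans s10).
have [W [T [bmW clockT indWT lf XW]]] := resetting_cycles.
have es1 : 1 <= expR s by rewrite -expR0 ler_expR.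
have [m tm m2] : exists2 m : nat, expR s < m%:R & m%:R <= 2 * expR s.
  exists (Num.truncn (expR s)).+1; first exact: truncnS_gt.
  by rewrite -natr1 [leRHS]mulr_natl [leRHS]mulr2n lerD// truncn_le// expR_ge0.
have s2 : s <= 1 + s ^+ 2 by have := sqr_ge0 (s - 1); rewrite sqrrB1; lra.
have s21 : 1 <= 1 + s ^+ 2 by rewrite lerDl sqr_ge0.
have sb0 : 0 <= (s + 8) / b by rewrite divr_ge0 ?addr_ge0// ltW.
(* m blocks of K cycles all contain a long one, up to probability 1 / 4 *)
have [K Klo Kup] : exists2 K : nat, (s + 8) / b <= K%:R & K%:R <= A1 * (1 + s ^+ 2).
  exists (Num.truncn ((s + 8) / b)).+1; first by rewrite ltW// truncnS_gt.
  have AE : A1 * (1 + s ^+ 2) = 9 * (1 + s ^+ 2) / b + (1 + s ^+ 2).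
    by rewrite /A1; field; rewrite gt_eqF.
  rewrite -natr1 AE; apply: lerD; last exact: s21.
  apply: (@le_trans _ _ ((s + 8) / b)); first by rewrite truncn_le.
  by rewrite ler_pM2r ?invr_gt0//; lra.
have a0 : 0 < enorm a.
  by rewrite (le_lt_trans _ aM)// !mulr_ge0// ?(ltW k0) ?(ltW d10).
have mS := survival_measurable a (expR_ge0 s).
have := hit_le D_gt0 eps0_gt0 bmW clockT indWT lf XW K g0 gr a0 (expR_ge0 s) tm.
rewrite -/C -/(survival (expR s) a) probability_setC//.
have PS := fin_num_measure P _ mS.
rewrite -(fineK PS) -[1%E]/((1 : R)%:E) -EFinB !lee_fin => H.
apply: half H _.
have -> : (2^-1 : R) = 4^-1 + 4^-1 by field.
apply: lerD.
  have -> : (1 - expR (- r)) ^+ K = expR (- b * K%:R).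
    by rewrite expRM_natr /b opprK lnK.
  apply: (@le_trans _ _ (2 * expR s * expR (- (s + 8)))).
    apply: ler_pM; rewrite ?expR_ge0// ler_expR mulNr lerN2.
    by move: Klo; rewrite ler_pdivrMr// mulrC.
  rewrite -mulrA -expRD (_ : s + - (s + 8) = - 8); last by ring.
  rewrite expRN ler_pdivrMr ?expR_gt0//.
  by have := expR_ge1Dx (8 : R); lra.
have ga : (1 + delta / 2) * s <= g * enorm a.
  have -> : (1 + delta / 2) * s = g * ((1 + delta) * kappa * s).
    by rewrite /g; field; rewrite !gt_eqF.
  by rewrite ler_wpM2l// ltW.
rewrite natrM.
apply: (@le_trans _ _ (2 * expR s * (A1 * (K1 * expR (delta / 4 * s))) *
    (C * expR (- ((1 + delta / 2) * s))))).
  apply: ler_pM; [by rewrite mulr_ge0|exact: mulr_ge0 C0 (expR_ge0 _)| |].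
    apply: ler_pM => //; apply: (le_trans Kup).
    by rewrite ler_wpM2l ?(ltW A10)// HK1.
  by rewrite ler_wpM2l// ler_expR mulNr lerN2.
have -> : 2 * expR s * (A1 * (K1 * expR (delta / 4 * s))) *
    (C * expR (- ((1 + delta / 2) * s))) =
    2 * (A1 * C * K1) * expR (- (delta / 4 * s)).
  rewrite (_ : - (delta / 4 * s) = s + delta / 4 * s + - ((1 + delta / 2) * s)).
    by rewrite !expRD; ring.
  by field.
by rewrite expRN ler_pdivrMr ?expR_gt0//; have := Hs1 s ss1; lra.
Qed.

End survival_asymptotics.

(** * The averaged survival probability *)

Section integral_bounds.
Context {R : realType} {dd : measure_display} {T : measurableType dd}.
Variable mu : probability T R.
Local Open Scope ereal_scope.

(** The integral of a nonnegative function being a supremum over the simple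
    functions below it, it is monotone without measurability. *)
Lemma le_integral_ge0 (f g : T -> \bar R) :
    (forall x, 0 <= f x) -> (forall x, f x <= g x) ->
  \int[mu]_x f x <= \int[mu]_x g x.
Proof.
move=> f0 fg; have g0 x : 0 <= g x by exact: le_trans (fg x).
rewrite !ge0_integralTE//; apply: ereal_sup_le => _ [h hf <-]; exists h => //= x.
exact: le_trans (fg x).
Qed.

Lemma integral_ge_cst (f : T -> \bar R) (A : set T) (c : R) :
    measurable A -> (0 <= c)%R -> (forall x, 0 <= f x) ->
    (forall x, A x -> c%:E <= f x) ->
  c%:E * mu A <= \int[mu]_x f x.
Proof.
move=> mA c0 f0 cf; rewrite -integral_cst// integral_mkcond.
apply: le_integral_ge0 => x; rewrite patchE; case: ifPn => //.
by rewrite inE; exact: cf.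
Qed.

Lemma integral_le_cst (f : T -> \bar R) (A : set T) (c : R) :
    measurable A -> (0 <= c)%R -> (forall x, 0 <= f x <= 1) ->
    (forall x, ~ A x -> f x <= c%:E) ->
  \int[mu]_x f x <= c%:E + mu A.
Proof.
move=> mA c0 f01 fc.
apply: (@le_trans _ _ (\int[mu]_x (c%:E + (\1_A x)%:E))).
  apply: le_integral_ge0 => x; first by have /andP[] := f01 x.
  rewrite indicE; case: (boolP (x \in A)) => xA.
    have /andP[_ f1] := f01 x; apply: (le_trans f1).
    by rewrite -EFinD lee_fin lerDr.
  by rewrite adde0 fc// => /mem_set; apply/negP.
have mI : measurable_fun setT (EFin \o (\1_A : T -> R)).
  by apply/measurable_EFinP; exact: measurable_indic.
have I0 : forall x, setT x -> 0 <= (EFin \o (\1_A : T -> R)) x.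
  by move=> x _; rewrite lee_fin.
have cI0 : forall x : T, setT x -> 0 <= (cst c%:E) x by move=> x _; rewrite lee_fin.
rewrite (ge0_integralD mu measurableT cI0 (measurable_cst _) I0 mI).
by rewrite integral_indic// setIT integral_cst// [X in _ * X](probability_setT mu) mule1.
Qed.

End integral_bounds.

Section logarithmic_limit.
Context {R : realType}.

Lemma cvg_lne_ratio (I : R -> \bar R) (L l : R) :
    (forall eta, 0 < eta -> exists s0, forall s, s0 <= s ->
      ((expR (- (L + eta) * s `^ l))%:E <= I (expR s) <=
       (expR (- (L - eta) * s `^ l))%:E)%E) ->
  (lne (I t) / (ln t `^ l)%:E)%E @[t --> +oo] --> (- L)%:E.
Proof.
move=> HI.
have H eta : 0 < eta -> exists s0, forall t, s0 <= t ->
    exists2 y, (lne (I t) / (ln t `^ l)%:E)%E = y%:E & `|- L - y| <= eta.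
  move=> eta0; have [s0 Hs0] := HI eta eta0.
  exists (expR (Num.max s0 1)) => t st.
  have t0 : 0 < t by exact: lt_le_trans (expR_gt0 _) st.
  have : Num.max s0 1 <= ln t by rewrite -ler_expR lnK.
  rewrite ge_max => /andP[s0t t1].
  have sl0 : 0 < ln t `^ l by rewrite powR_gt0// (lt_le_trans ltr01).
  have := Hs0 _ s0t; rewrite lnK ?posrE//.
  case: (I t) => [i||] /andP[lo up] //.
  have i0 : 0 < i by rewrite -lte_fin (lt_le_trans _ lo)// lte_fin expR_gt0.
  exists (ln i / ln t `^ l); first by rewrite lne_EFin// inver gt_eqF.
  have lo' : - (L + eta) * ln t `^ l <= ln i.
    by rewrite -ler_expR (lnK i0) -lee_fin.
  have up' : ln i <= - (L - eta) * ln t `^ l.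
    by rewrite -ler_expR (lnK i0) -lee_fin.
  rewrite -ler_pdivlMr// in lo'; rewrite -ler_pdivrMr// in up'.
  by rewrite ler_norml; apply/andP; split; lra.
apply/fine_cvgP; split.
  have [s0 Hs0] := H 1 ltr01; near=> t.
  have [|y -> _ //] := Hs0 t.
  by near: t; apply: nbhs_pinfty_ge; exact: num_real.
apply/cvgrPdist_le => eta eta0; have [s0 Hs0] := H eta eta0; near=> t.
have [|y yE yL] := Hs0 t; last by rewrite /= yE.
by near: t; apply: nbhs_pinfty_ge; exact: num_real.
Unshelve. all: end_near. Qed.

End logarithmic_limit.

Section averaged_survival.
Context {R : realType} {dd : measure_display} {Omega : measurableType dd}.
Variable P : probability Omega R.
Context {d : nat}.
Variables (D r B l eps0 : R) (X : R -> Omega -> d.-tuple R).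
Variables (mu : probability (d.-tuple R) R) (f : d.-tuple R -> R).
Hypotheses (D_gt0 : 0 < D) (r_gt0 : 0 < r) (B_gt0 : 0 < B) (l_gt0 : 0 < l).
Hypotheses (eps0_gt0 : 0 < eps0) (d_gt0 : (0 < d)%N).
Hypothesis mu_density : has_density mu f.
Hypothesis f_tail :
  (lne (f a)%:E / (enorm a `^ l)%:E)%E @[a --> einfty] --> (- B)%:E.
Hypothesis X_reset : resetting_brownian_motion P D r eorigin X.

Let k := kappa D r.
Let L := B * k `^ l.

Let k_gt0 : 0 < k. Proof. exact: kappa_gt0. Qed.

Let kl_gt0 : 0 < k `^ l. Proof. by rewrite powR_gt0. Qed.

Let powR_root (x : R) : 0 <= x -> (x `^ l^-1) `^ l = x.
Proof. by move=> x0; rewrite -powRrM mulVf ?gt_eqF// powRr1. Qed.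

(** Targets beyond (1 + delta) kappa s contribute at least half of their mass. *)
Lemma averaged_survival_ge (eta : R) : 0 < eta ->
  exists s0, forall s, s0 <= s ->
    ((expR (- (L + eta) * s `^ l))%:E <=
     \int[mu]_a P (survival eps0 X (expR s) a))%E.
Proof.
move=> eta0; pose eta1 := eta / (2 * k `^ l).
have eta10 : 0 < eta1 by rewrite divr_gt0// mulr_gt0.
have eta12 : 0 < eta1 / 2 by rewrite divr_gt0.
have Be : 0 < B + eta1 / 2 by rewrite addr_gt0.
(* a radius larger by the factor q costs as much as replacing eta1 / 2 by eta1 *)
pose q := ((B + eta1) / (B + eta1 / 2)) `^ l^-1.
have ql : (B + eta1 / 2) * q `^ l = B + eta1.
  rewrite powR_root ?divr_ge0 ?(ltW Be)//; last by rewrite addr_ge0// ltW.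
  by rewrite mulrC divfK// gt_eqF.
have q1 : 1 < q.
  have : 1 `^ l < q `^ l.
    rewrite powR1 -(ltr_pM2l Be) ql mulr1; lra.
  apply: contraTT; rewrite -!leNgt => q1.
  by apply: ge0_ler_powR; rewrite ?nnegrE ?powR_ge0// ltW.
pose delta := (q - 1) / 2.
have delta0 : 0 < delta by rewrite divr_gt0// subr_gt0.
have [s1 s10 Hs1] := survival_far_ge D_gt0 r_gt0 eps0_gt0 X_reset delta0.
have [M0 M00 HM0] := outside_ball_mass_ge B_gt0 l_gt0 d_gt0 mu_density f_tail eta12.
have [s2 s20 Hs2] := powR_ge_threshold 1 l_gt0 (divr_gt0 eta0 (@ltr0n R 2)).
exists (Num.max s1 (Num.max s2 (Num.max (M0 / k) (d%:R / (delta * k))))).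
move=> s; rewrite !ge_max => /and4P[ss1 ss2 sM0 sd].
have s0 : 0 <= s by rewrite (le_trans s10).
pose M := (1 + delta) * k * s.
have M0M : M0 <= M.
  move: sM0; rewrite ler_pdivrMr// /M => sM0.
  have ks0 : 0 <= s * k by rewrite mulr_ge0// ltW.
  have : 0 <= delta * (s * k) by rewrite mulr_ge0// ltW.
  lra.
have Mq : M + d%:R <= q * k * s.
  move: sd; rewrite (ler_pdivrMr _ _ (mulr_gt0 delta0 k_gt0)) => sd.
  rewrite (_ : q * k * s = M + s * (delta * k)) ?lerD2l//.
  by rewrite /M /delta; field.
pose F a := P (survival eps0 X (expR s) a).
have F0 a : (0 <= F a)%E by exact: measure_ge0.
have half0 : 0 <= 2^-1 :> R by [].
apply: (le_trans _ (integral_ge_cst mu (measurable_outside_ball M) half0 F0 _));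
  last by move=> a Ma; exact: Hs1.
apply: (@le_trans _ _ (2^-1%:E * (expR (- (B + eta1 / 2) * (M + d%:R) `^ l))%:E)%E).
  rewrite -EFinM lee_fin.
  apply: (@le_trans _ _ (expR (- 1) * expR (- (L + eta / 2) * s `^ l))).
    by rewrite -expRD ler_expR; have := Hs2 s ss2; lra.
  apply: ler_pM; rewrite ?expR_ge0//.
    by rewrite expRN lef_pV2 ?posrE ?expR_gt0//; have := expR_ge1Dx (1 : R); lra.
  rewrite ler_expR !mulNr lerN2.
  have LE : (L + eta / 2) * s `^ l = (B + eta1 / 2) * (q * k * s) `^ l.
    rewrite !powRM ?mulr_ge0 ?powR_ge0 ?(ltW k_gt0)// !mulrA ql.
    by rewrite /L /eta1; field; rewrite gt_eqF.
  rewrite LE ler_wpM2l ?(ltW Be)//; apply: ge0_ler_powR => //; first exact: ltW.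
    by rewrite nnegrE addr_ge0// (le_trans M00).
  by rewrite nnegrE !mulr_ge0 ?powR_ge0 ?(ltW k_gt0).
by apply: lee_wpmul2l; [rewrite lee_fin|exact: HM0].
Qed.

(** Targets beyond (1 - delta) kappa s contribute at most their mass, and the
    other ones at most a probability that is negligible by the choice of the rate
    in [survival_near_le]. *)
Lemma averaged_survival_le (eta : R) : 0 < eta ->
  exists s0, forall s, s0 <= s ->
    (\int[mu]_a P (survival eps0 X (expR s) a) <=
     (expR (- (L - eta) * s `^ l))%:E)%E.
Proof.
move=> eta0; pose eta1 := Num.min (eta / (2 * k `^ l)) (B / 2).
have eta10 : 0 < eta1 by rewrite lt_min !divr_gt0// mulr_gt0.
have eta1B : eta1 <= B / 2 by rewrite ge_min lexx orbT.
have eta1k : eta1 * k `^ l <= eta / 2.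
  rewrite -ler_pdivlMr// ge_min (_ : eta / 2 / k `^ l = eta / (2 * k `^ l)) ?lexx//.
  by rewrite invfM mulrA.
have eta12 : 0 < eta1 / 2 by rewrite divr_gt0.
have eta12B : eta1 / 2 < B by lra.
have Be : 0 < B - eta1 / 2 by lra.
(* a radius smaller by the factor q costs as much as replacing eta1 / 2 by eta1 *)
pose q := ((B - eta1) / (B - eta1 / 2)) `^ l^-1.
have x0 : 0 < (B - eta1) / (B - eta1 / 2) by rewrite divr_gt0//; lra.
have ql : (B - eta1 / 2) * q `^ l = B - eta1.
  by rewrite powR_root ?(ltW x0)// mulrC divfK// gt_eqF.
have q0 : 0 < q by rewrite powR_gt0.
have q1 : q < 1.
  have : q `^ l < 1 `^ l.
    rewrite powR1 -(ltr_pM2l Be) ql mulr1; lra.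
  apply: contraTT; rewrite -!leNgt => q1.
  by apply: ge0_ler_powR; rewrite ?nnegrE ?powR_ge0// ltW.
pose delta := 1 - q.
have delta0 : 0 < delta by rewrite subr_gt0.
have delta1 : delta < 1 by rewrite gtrBl.
have L0 : 0 <= L by rewrite mulr_ge0 ?powR_ge0// ltW.
have [s1 s11 Hs1] := survival_near_le D_gt0 r_gt0 eps0_gt0 d_gt0 X_reset l
  delta0 delta1 L0.
have [C C0 [M0 M00 HM0]] := outside_ball_mass_le l_gt0 mu_density f_tail eta12 eta12B.
have [s2 s20 Hs2] := powR_ge_threshold (C + 2) l_gt0 (divr_gt0 eta0 (@ltr0n R 2)).
exists (Num.max s1 (Num.max s2 (M0 / (q * k)))).
move=> s; rewrite !ge_max => /and3P[ss1 ss2 sM0].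
have s0 : 0 <= s by rewrite (le_trans _ ss1)// (le_trans _ s11).
have qE : (1 - delta) * k * s = q * k * s by rewrite /delta opprB addrC subrK.
pose M := q * k * s.
have M0M : M0 <= M by move: sM0; rewrite ler_pdivrMr ?mulr_gt0// mulrC.
have c0 : 0 <= 2 * expR (- (L * s `^ l)) by rewrite mulr_ge0 ?expR_ge0.
apply: le_trans (integral_le_cst mu (measurable_outside_ball M) c0 _ _) _.
- move=> a; rewrite measure_ge0 probability_le1//.
  by apply: (survival_measurable _ X_reset); exact: expR_ge0.
- by move=> a /negP; rewrite -leNgt => aM; apply: (Hs1 s ss1); rewrite qE.
apply: (@le_trans _ _ ((2 * expR (- (L * s `^ l)))%:E +
    (C * expR (- (B - eta1 / 2) * M `^ l))%:E)%E).
  by rewrite leeD2l// HM0.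
rewrite -EFinD lee_fin; pose E := expR (- (L - eta / 2) * s `^ l).
have sl0 : 0 <= s `^ l by exact: powR_ge0.
apply: (@le_trans _ _ (2 * E + C * E)).
  apply: lerD.
    rewrite ler_wpM2l// ler_expR.
    by have := mulr_ge0 (ltW eta0) sl0; lra.
  rewrite ler_wpM2l ?(ltW C0)// ler_expR !mulNr lerN2.
  rewrite /M !powRM ?mulr_ge0 ?powR_ge0 ?(ltW k_gt0)// !mulrA ql.
  rewrite ler_wpM2r// /L; lra.
rewrite -mulrDl (_ : - (L - eta) * s `^ l = eta / 2 * s `^ l + - (L - eta / 2) * s `^ l).
  rewrite expRD ler_wpM2r ?expR_ge0// addrC (le_trans (Hs2 s ss2))//.
  by apply: le_trans (expR_ge1Dx _); rewrite lerDr.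
by field.
Qed.

End averaged_survival.

Theorem theorem1 (R : realType) (D r B l eps0 : R) (d : nat)
    (D_gt0 : 0 < D) (r_gt0 : 0 < r) (B_gt0 : 0 < B) (l_gt0 : 0 < l)
    (eps0_gt0 : 0 < eps0) (d_gt0 : (0 < d)%N)
    (mu : probability (d.-tuple R) R) (f : d.-tuple R -> R)
    (mu_density : has_density mu f)
    (f_tail :
      (lne (f a)%:E / (enorm a `^ l)%:E)%E @[a --> einfty] --> (- B)%:E)
    (disp : measure_display) (Omega : measurableType disp)
    (P : probability Omega R) (X : R -> Omega -> d.-tuple R)
    (X_reset : resetting_brownian_motion P D r eorigin X) :
  (lne (\int[mu]_a P [set w | (t%:E < location_time eps0 a (X ^~ w))%E])
     / (ln t `^ l)%:E)%E @[t --> +oo]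
  --> (- B * (D / (2 * r)) `^ (l / 2))%:E.
Proof.
have kE : - B * (D / (2 * r)) `^ (l / 2) = - (B * kappa D r `^ l).
  rewrite mulNr; congr (- (_ * _)).
  have x0 : 0 <= D / (2 * r) by rewrite divr_ge0 ?mulr_ge0// ltW.
  by rewrite /kappa -powR12_sqrt// -powRrM [l / 2]mulrC.
rewrite kE; apply: (cvg_lne_ratio (I := fun t =>
  (\int[mu]_a P (survival eps0 X t a))%E)) => eta eta0.
have [s1 Hs1] := averaged_survival_ge D_gt0 r_gt0 B_gt0 l_gt0 eps0_gt0 d_gt0
  mu_density f_tail X_reset eta0.
have [s2 Hs2] := averaged_survival_le D_gt0 r_gt0 B_gt0 l_gt0 eps0_gt0 d_gt0
  mu_density f_tail X_reset eta0.
exists (Num.max s1 s2) => s; rewrite ge_max => /andP[ss1 ss2].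
by rewrite Hs1// Hs2.
Qed.
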